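(* Let $P=\{p_1,\dots,p_t\}$ be a finite set of $t\ge 2$ distinct primes, and let $A$ be the set of positive integers that are products of powers of primes from $P$. For a positive integer $k$, let $F(k)$ be the smallest positive integer which cannot be represented in the form $\sum_{i=1}^{k}a_i$ with $a_i\in A\cup\{0\}$ for all $i$, and let $F_{\pm}(k)$ be the smallest positive integer which cannot be represented in the form $\sum_{i=1}^{k}a_i$ with $a_i\in A_{\pm}\cup\{0\}$ for all $i$. Then for every $\varepsilon>0$ there are a positive number $c$ depending only on the two smallest elements of $P$, a number $C$ depending only on $\varepsilon$, and an absolute constant $C_{\pm}$ such that: (i) $F(k)>k^{ck}$ for all $k>1$; (ii) $F(k)\le C(kt)^{(1+\varepsilon)kt}$ for all $k>1$; (iii) $F_{\pm}(k)<\exp\big((kt)^{C_{\pm}}\big)$ for all $k>1$.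
   Context: The exponents in the power products defining $A$ are nonnegative integers, so $1\in A$. $A_{\pm}=A\cup(-A)$, where $-A=\{-a: a\in A\}$. In the claim, $c$ depends only on the two smallest primes in $P$ (not on $k$ or $\varepsilon$), $C$ depends only on $\varepsilon$ (not on $P$, $t$ or $k$), and $C_{\pm}$ is independent of $P$, $t$, $k$ and $\varepsilon$. *)

(* Defs.v *)
From mathcomp Require Import all_boot all_order all_algebra finmap.
From mathcomp Require Import all_classical all_reals all_analysis.

Set Implicit Arguments.
Unset Strict Implicit.
Unset Printing Implicit Defensive.

Import GRing.Theory Num.Theory.

Local Open Scope classical_set_scope.
Local Open Scope ring_scope.

(* The exponents are natural numbers, possibly zero. *)
Definition power_products (P : {fset nat}) : set int :=
  [set a | exists e : nat -> nat, a = (\prod_(p <- P) p ^ e p)%N%:Z].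

Definition signed_power_products (P : {fset nat}) : set int :=
  power_products P `|` [set - a | a in power_products P].

Definition sum_of (k : nat) (S : set int) (n : int) : Prop :=
  exists a : 'I_k -> int,
    (forall i, (S `|` [set 0]) (a i)) /\ n = \sum_(i < k) a i.

Definition least_non_sum (k : nat) (S : set int) (n : nat) : Prop :=
  [/\ (0 < n)%N, ~ sum_of k S n%:Z &
      forall m : nat, (0 < m)%N -> ~ sum_of k S m%:Z -> (n <= m)%N].

(* Counted from 0; the value is junk when [P] has at most [i] elements. *)
Definition nth_smallest (P : {fset nat}) (i : nat) : nat :=
  nth 0%N (sort leq P) i.

(* Main.v *)
(**
(i) Let [p], [q] be the two smallest primes and [p ^ v] the exact power of [p]
dividing [q ^ d - 1], where [p ^ 2] divides [q ^ d - 1]. Every residue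
[1 mod p ^ v] is, modulo [p ^ m], a power [q ^ (d j)] with [j < p ^ m]. Hence
the [m] lowest base-[p] digits of a large [n] can be cleared by subtracting one
power of [q] and fewer than [p ^ v] ones. With [p ^ m] of order [k], this writes
every [n <= k ^ (c k)] as a sum of [k] numbers [p ^ a q ^ b]; no lower bound for
linear forms in logarithms is needed.

(ii) A power product at most [N] has all exponents at most [log2 N], so [k]-fold
sums represent at most [(2 + log2 N) ^ (k t)] integers up to [N].

(iii) If [a ^ (L + 1) = a] modulo [m] for all [a], then signed [k]-fold sums meet
at most [(1 + 2 (L + 1) ^ t) ^ k] classes modulo [m]; if this is less than [m],
then [F_pm k <= m]. Take for [m] the product of the primes [p <= x] such that
[p - 1] has no prime factor above [y = x ^ (1 - 1 / N)], and [L] a power of [y!].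
Following Erdos, a constant proportion of the primes up to [x] has this property
when [N] is a large constant: otherwise [p = a r + 1] with [r > y] prime and
[a <= x / y], and for fixed [a] Selberg's sieve bounds the number of such [r].
*)
Require Import Defs.
From mathcomp Require Import all_boot all_order all_algebra finmap.
From mathcomp Require Import all_classical all_reals all_analysis.
From mathcomp Require Import zify ring lra.
From mathcomp Require cyclic.

Set Implicit Arguments.
Unset Strict Implicit.
Unset Printing Implicit Defensive.

Import Order.TTheory GRing.Theory Num.Theory.

Local Open Scope ring_scope.

(** * A Selberg sieve with two forbidden classes *)

Section PeriodicSums.

(** By the Chinese remainder theorem, reduction modulo [D] and modulo [l] is a bijection onto the
    pairs of residues. *)
Lemma sum_coprime_period (R : comPzRingType) (D l : nat) (F f : nat -> R) :
    (0 < D)%N -> (0 < l)%N -> coprime D l ->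
    (forall r, F (r %% D)%N = F r) -> (forall r, f (r %% l)%N = f r) ->
  \sum_(0 <= r < D * l) F r * f r =
  (\sum_(0 <= r < D) F r) * (\sum_(0 <= r < l) f r).
Proof.
move=> D0 l0 co perF perf.
rewrite !big_mkord big_distrlr /= pair_bigA /=.
pose g (r : 'I_(D * l)) : 'I_D * 'I_l :=
  (Ordinal (ltn_pmod r D0), Ordinal (ltn_pmod r l0)).
have g_inj : injective g.
  move=> r1 r2 [eqD eql]; apply/val_inj => /=.
  have /eqP := chinese_remainder co r1 r2.
  by rewrite eqD eql !eqxx /= !modn_small // => /eqP.
have g_bij : bijective g.
  by apply: inj_card_bij => //; rewrite card_prod !card_ord.
rewrite (reindex g) /=; last exact: onW_bij.
by apply: eq_bigr => r _; rewrite perF perf.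
Qed.

Lemma sum_periods (R : pzRingType) (D q : nat) (f : nat -> R) :
    (forall r, f (r %% D)%N = f r) ->
  \sum_(0 <= r < q * D) f r = (\sum_(0 <= r < D) f r) *+ q.
Proof.
move=> perf; elim: q => [|q IHq]; first by rewrite mul0n big_geq.
rewrite (@big_cat_nat _ _ _ (q * D)) //=; last by rewrite mulSn leq_addl.
rewrite IHq mulrSr; congr (_ + _).
rewrite -{1}[(q * D)%N]add0n big_addn mulSn addnK.
by apply: eq_bigr => r _; rewrite -perf addnC modnMDl perf.
Qed.

(** Rounding [Y] up to a multiple of [D] only adds nonnegative terms, and the multiple is at most
    [Y + D]. *)
Lemma sum_periodic_le (R : realDomainType) (D Y : nat) (f : nat -> R) (S : R) :
    (0 < D)%N -> (forall r, f (r %% D)%N = f r) -> (forall r, 0 <= f r) ->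
    \sum_(0 <= r < D) f r = D%:R * S ->
  \sum_(0 <= r < Y) f r <= (Y + D)%:R * S.
Proof.
move=> D0 perf f0 sumf.
have S0 : 0 <= S.
  have : 0 <= D%:R * S by rewrite -sumf sumr_ge0.
  by rewrite pmulr_rge0 // ltr0n.
apply: (@le_trans _ _ (\sum_(0 <= r < (Y %/ D).+1 * D) f r)).
  have leY : (Y <= (Y %/ D).+1 * D)%N by apply: ltnW; rewrite -ltn_divLR.
  by rewrite [leRHS](@big_cat_nat _ _ _ Y) //= lerDl sumr_ge0.
rewrite sum_periods // sumf -mulrnAl -mulrnA ler_wpM2r // ler_nat.
by rewrite mulnC mulSn addnC leq_add2r leq_trunc_div.
Qed.

(** Full periods cancel, and fewer than [D] terms remain. *)
Lemma sum_periodic_bound (R : realDomainType) (D Y : nat) (f : nat -> R) (B : R) :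
    (0 < D)%N -> (forall r, f (r %% D)%N = f r) -> (forall r, `|f r| <= B) ->
    \sum_(0 <= r < D) f r = 0 ->
  `|\sum_(0 <= r < Y) f r| <= D%:R * B.
Proof.
move=> D0 perf fB sumf.
rewrite (@big_cat_nat _ _ _ (Y %/ D * D)) //=; last exact: leq_trunc_div.
rewrite sum_periods // sumf mul0rn add0r.
apply: le_trans (ler_norm_sum _ _ _) _.
apply: (@le_trans _ _ (\sum_(Y %/ D * D <= r < Y) B)); first exact: ler_sum.
rewrite sumr_const_nat -[_ *+ _]mulr_natl ler_wpM2r //.
  exact: le_trans (normr_ge0 _) (fB 0%N).
by rewrite ler_nat {1}(divn_eq Y D) addKn ltnW // ltn_pmod.
Qed.

End PeriodicSums.

(** [n] is compared with its radical. This excludes 0, since [primes 0] is empty. *)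
Definition squarefree (n : nat) : bool := (\prod_(l <- primes n) l == n)%N.

Lemma prod_periodic (R : comPzRingType) (s : seq nat) (f : nat -> nat -> R) (D : nat) :
    {in s, forall l, l %| D}%N -> {in s, forall l r, f l (r %% l)%N = f l r} ->
  forall r, \prod_(l <- s) f l (r %% D)%N = \prod_(l <- s) f l r.
Proof.
move=> sD perf r; apply: eq_big_seq => l ls.
by rewrite -perf // modn_dvdm ?sD // perf.
Qed.

Lemma sum_prod_periodic (R : comPzRingType) (s : seq nat) (f : nat -> nat -> R) :
    uniq s -> all prime s -> {in s, forall l r, f l (r %% l)%N = f l r} ->
  \sum_(0 <= r < \prod_(l <- s) l) \prod_(l <- s) f l r =
  \prod_(l <- s) \sum_(0 <= r < l) f l r.
Proof.
elim: s => [|l s IHs] /=; first by rewrite !big_nil big_nat1 big_nil.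
move=> /andP[lNs us] /andP[pl ps] perf.
have perfs : {in s, forall l r, f l (r %% l)%N = f l r}.
  by move=> l' l's; apply: perf; rewrite inE l's orbT.
rewrite !big_cons -IHs //.
under [LHS]eq_bigr do rewrite big_cons.
have pD : (0 < \prod_(j <- s) j)%N.
  by rewrite big_seq prodn_cond_gt0 // => i /(allP ps)/prime_gt0.
apply: (@sum_coprime_period _ _ _ (f l) (fun r => \prod_(j <- s) f j r)) => //.
- exact: prime_gt0.
- rewrite prime_coprime //; apply/negP.
  elim: s ps lNs {IHs us perf perfs pD} => [_ _|q s IHs /= /andP[pq ps]].
    by rewrite big_nil dvdn1 => /eqP l1; rewrite l1 in pl.
  rewrite inE negb_or => /andP[lq lNs].
  rewrite big_cons Euclid_dvdM // => /orP[|]; last exact: IHs.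
  by rewrite dvdn_prime2 // (negbTE lq).
- by apply: perf; rewrite inE eqxx.
- by apply: prod_periodic => // j js; rewrite (big_rem j) //= dvdn_mulr.
Qed.

(** * Selberg's inequality *)

Section Sieve.
Variables (R : realFieldType) (bad : nat -> nat -> bool) (I : pred nat) (z : nat).
Hypothesis bad_period : forall l r, prime l -> bad l (r %% l)%N = bad l r.
Hypothesis I_squarefree : forall n, I n -> squarefree n.
(** For a prime [l] this amounts to [5 <= l]; it keeps [sieve_weight l] between 0 and 1. *)
Hypothesis I_ge5 : forall n l, I n -> l \in primes n -> (4 <= l)%N.
Hypothesis bad2 : forall n l, I n -> l \in primes n ->
  (\sum_(0 <= r < l) bad l r)%N = 2.

(* [sieve_char l] is normalised to be 1 on the surviving classes modulo [l] and to
   have mean 0; its mean square is then the inverse of [sieve_weight l]. *)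
Definition sieve_weight (l : nat) : R := 2 / (l%:R - 2).
Definition sieve_char (l r : nat) : R := if bad l r then - (l%:R - 2) / 2 else 1.

(** Scaling each character by its weight makes [H n] both the value of [Psi n] at the sifted
    integers and its mean square over a period. *)
Let H (n : nat) : R := \prod_(l <- primes n) sieve_weight l.
Let Psi (n r : nat) : R := \prod_(l <- primes n) (sieve_weight l * sieve_char l r).

Let l4 n l : I n -> l \in primes n -> 4 <= l%:R :> R.
Proof. by move=> In ln; rewrite (ler_nat _ 4) (I_ge5 In). Qed.

Let sum_bad n l : I n -> l \in primes n ->
  \sum_(0 <= r < l) (bad l r)%:R = 2 :> R.
Proof. by move=> In ln; rewrite -natr_sum (bad2 In ln). Qed.

(** The two bad classes, of value [- (l - 2) / 2], balance the [l - 2] others, of value 1. *)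
Lemma sum_sieve_char n l : I n -> l \in primes n ->
  \sum_(0 <= r < l) (sieve_weight l * sieve_char l r) = 0.
Proof.
move=> In ln; have := l4 In ln => hl.
rewrite -big_distrr /=.
rewrite (eq_bigr (fun r => 1 - l%:R / 2 * (bad l r)%:R)); last first.
  by move=> r _; rewrite /sieve_char; case: (bad l r) => /=; field.
rewrite sumrB -big_distrr /= (sum_bad In ln) sumr_const_nat subn0.
by field; lra.
Qed.

Lemma sum_sieve_char_sqr n l : I n -> l \in primes n ->
  \sum_(0 <= r < l) (sieve_weight l * sieve_char l r) ^+ 2 = l%:R * sieve_weight l.
Proof.
move=> In ln; have := l4 In ln => hl.
under eq_bigr do rewrite exprMn.
rewrite -big_distrr /=.
rewrite (eq_bigr (fun r => 1 + ((l%:R - 2) ^+ 2 / 4 - 1) * (bad l r)%:R)); last first.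
  by move=> r _; rewrite /sieve_char; case: (bad l r) => /=; field.
rewrite big_split /= -big_distrr /= (sum_bad In ln) sumr_const_nat subn0.
by rewrite /sieve_weight; field; lra.
Qed.

Lemma sieve_weight_ge0 n l : I n -> l \in primes n -> 0 <= sieve_weight l <= 1.
Proof.
move=> In ln; have := l4 In ln => hl; rewrite /sieve_weight.
by rewrite divr_ge0 ?ler_pdivrMr ?mul1r //=; lra.
Qed.

Lemma sieve_char_le1 n l r : I n -> l \in primes n ->
  `|sieve_weight l * sieve_char l r| <= 1.
Proof.
move=> In ln; have /andP[h0 h1] := sieve_weight_ge0 In ln.
rewrite /sieve_char; case: (bad l r); last by rewrite mulr1 ger0_norm.
have := l4 In ln => hl.
suff -> : sieve_weight l * (- (l%:R - 2) / 2) = -1 by rewrite normrN1.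
by rewrite /sieve_weight; field; lra.
Qed.

Lemma Psi_le1 n r : I n -> `|Psi n r| <= 1.
Proof.
move=> In; rewrite normr_prod big_seq; apply: prodr_ile1 => l ln.
by rewrite normr_ge0 (sieve_char_le1 r In ln).
Qed.

Lemma H_bounds n : I n -> 0 <= H n <= 1.
Proof.
move=> In; rewrite /H big_seq; apply/andP; split.
  by apply: prodr_ge0 => l ln; case/andP: (sieve_weight_ge0 In ln).
by apply: prodr_ile1 => l ln; exact: sieve_weight_ge0 In ln.
Qed.

Let char_period l r : prime l ->
  sieve_weight l * sieve_char l (r %% l)%N = sieve_weight l * sieve_char l r.
Proof. by move=> pl; rewrite /sieve_char bad_period. Qed.

Let primesP n : all prime (primes n).
Proof. by apply/allP => l; rewrite mem_primes => /andP[]. Qed.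

Let prime_of n l : l \in primes n -> prime l.
Proof. exact: (allP (primesP n)). Qed.

Lemma Psi_period n D r : (n %| D)%N -> Psi n (r %% D)%N = Psi n r.
Proof.
move=> nD; apply: (@prod_periodic R (primes n)
  (fun l r => sieve_weight l * sieve_char l r)).
  by move=> l; rewrite mem_primes => /and3P[_ _ ln]; exact: dvdn_trans ln nD.
by move=> l ln r'; rewrite char_period // (prime_of ln).
Qed.

Lemma sum_Psi_sqr n Y : I n ->
  \sum_(0 <= r < Y) Psi n r ^+ 2 <= (Y + n)%:R * H n.
Proof.
move=> In; have /eqP sqn := I_squarefree In.
have n0 : (0 < n)%N.
  by rewrite -sqn big_seq prodn_cond_gt0 // => l /prime_of/prime_gt0.
apply: sum_periodic_le => //.
- by move=> r; rewrite Psi_period.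
- by move=> r; rewrite sqr_ge0.
rewrite -{1}sqn.
under [LHS]eq_bigr do rewrite /Psi -prodrXl.
rewrite (sum_prod_periodic (f := fun l r => (sieve_weight l * sieve_char l r) ^+ 2)).
- rewrite -{2}sqn natr_prod -big_split /=.
  by apply: eq_big_seq => l ln; rewrite (sum_sieve_char_sqr In).
- exact: primes_uniq.
- exact: primesP.
by move=> l ln r; rewrite char_period // (prime_of ln).
Qed.

Let I_gt0 n : I n -> (0 < n)%N.
Proof.
move=> In; have /eqP <- := I_squarefree In.
by rewrite big_seq prodn_cond_gt0 // => l /prime_of/prime_gt0.
Qed.

(** Over a period [n * m] the factor at [l] separates by the Chinese remainder theorem and has mean
    0. Only an incomplete period contributes, with terms of absolute value at most 1. *)
Lemma sum_Psi_cross_aux n m l Y : I n -> I m -> l \in primes n -> l \notin primes m ->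
  `|\sum_(0 <= r < Y) Psi n r * Psi m r| <= (n * m)%:R.
Proof.
move=> In Im ln lm; have /eqP sqn := I_squarefree In.
rewrite -[leRHS]mulr1.
apply: (@sum_periodic_bound R (n * m) Y (fun r => Psi n r * Psi m r) 1).
- by rewrite muln_gt0; apply/andP; split; exact: I_gt0.
- by move=> r; rewrite Psi_period ?dvdn_mulr ?Psi_period ?dvdn_mull.
- by move=> r; rewrite normrM mulr_ile1 ?normr_ge0 ?Psi_le1.
pose s := rem l (primes n).
pose g r := (\prod_(j <- s) (sieve_weight j * sieve_char j r)) * Psi m r.
have sp : {in s, forall j, prime j} by move=> j /mem_rem/prime_of.
have pl := prime_of ln.
have defn : n = (l * \prod_(j <- s) j)%N by rewrite -{1}sqn (big_rem l).
have lNs : ~~ (l %| \prod_(j <- s) j)%N.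
  rewrite Euclid_dvd_prod // big_has; apply/hasPn => j js.
  rewrite (dvdn_prime2 pl (sp _ js)); apply/eqP => lj; move: js.
  by rewrite -lj /s mem_rem_uniq ?primes_uniq // inE eqxx.
have sumE := @sum_coprime_period R ((\prod_(j <- s) j) * m) l g
  (fun r => sieve_weight l * sieve_char l r).
have -> : (n * m = \prod_(j <- s) j * m * l)%N by rewrite [in LHS]defn -mulnA mulnC.
rewrite (eq_bigr (fun r => g r * (sieve_weight l * sieve_char l r))); last first.
  by move=> r _; rewrite /g {1}/Psi (big_rem l) //= mulrC !mulrA mulrC !mulrA.
rewrite sumE ?(sum_sieve_char In ln) ?mulr0 //.
- rewrite muln_gt0 (I_gt0 Im) andbT big_seq prodn_cond_gt0 // => j /sp.
  exact: prime_gt0.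
- exact: prime_gt0.
- rewrite coprime_sym prime_coprime // Euclid_dvdM // negb_or lNs /=.
  by move: lm; rewrite mem_primes pl (I_gt0 Im).
- move=> r; rewrite /g Psi_period ?dvdn_mull //; congr (_ * _).
  apply: (@prod_periodic R s (fun l r => sieve_weight l * sieve_char l r)).
    by move=> j js; rewrite (big_rem j) //= -mulnA dvdn_mulr.
  by move=> j /sp pj r'; rewrite char_period.
- by move=> r; rewrite char_period.
Qed.

(** Two distinct squarefree integers have different sets of primes, so some prime divides exactly
    one of them. *)
Lemma sum_Psi_cross n m Y : I n -> I m -> n != m ->
  `|\sum_(0 <= r < Y) Psi n r * Psi m r| <= (n * m)%:R.
Proof.
move=> In Im nm.
have [|] := boolP (has (fun l => l \notin primes m) (primes n)).
  by case/hasP => l ln lm; exact: sum_Psi_cross_aux ln lm.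
have [/hasP[l lm ln] _|] := boolP (has (fun l => l \notin primes n) (primes m)).
  under eq_bigr do rewrite mulrC.
  by rewrite mulnC; exact: sum_Psi_cross_aux lm ln.
move=> /hasPn h1 /hasPn h2; case/negP: nm; apply/eqP.
have /eqP <- := I_squarefree In; have /eqP <- := I_squarefree Im.
congr (\prod_(l <- _) l)%N; apply: (irr_sorted_eq ltn_trans ltnn).
- exact: sorted_primes.
- exact: sorted_primes.
by move=> l; apply/idP/idP => [/h2|/h1]; rewrite negbK.
Qed.

(** The denominator in Selberg's upper bound, whose main term is [Y / sieve_total]. *)
Definition sieve_total : R :=
  \sum_(1 <= n < z.+1 | I n) \prod_(l <- primes n) sieve_weight l.

(* The function [\sum_n Psi n] equals [sieve_total] at every sifted [r], while the
   [Psi n] are orthogonal over full periods; expand the sum of its squares. *)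
Lemma sieve_bound Y (T : pred nat) :
    (forall r, T r -> forall n l, I n -> (n <= z)%N -> l \in primes n -> ~~ bad l r) ->
  (\sum_(0 <= r < Y) T r)%:R * sieve_total ^+ 2 <=
    Y%:R * sieve_total + (z ^ 4)%:R.
Proof.
set G := sieve_total => TP.
pose F r := \sum_(1 <= n < z.+1 | I n) Psi n r.
have FT r : T r -> F r = G.
  move=> Tr; rewrite /F /G /sieve_total big_nat_cond [RHS]big_nat_cond.
  apply: eq_bigr => n /andP[/andP[_ nz] In]; apply: eq_big_seq => l ln.
  by rewrite /sieve_char (negbTE (TP _ Tr _ _ In nz ln)) mulr1.
apply: (@le_trans _ _ (\sum_(0 <= r < Y) F r ^+ 2)).
  rewrite natr_sum mulr_suml; apply: ler_sum => r _.
  case Tr: (T r); first by rewrite mul1r FT.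
  by rewrite mul0r sqr_ge0.
rewrite (eq_bigr (fun r => \sum_(1 <= n < z.+1 | I n) \sum_(1 <= m < z.+1 | I m)
  Psi n r * Psi m r)); last first.
  by move=> r _; rewrite expr2 big_distrlr.
rewrite exchange_big /=.
have znat : (z ^ 4)%:R = \sum_(1 <= n < z.+1) \sum_(1 <= m < z.+1) (z * z)%:R :> R.
  rewrite !sumr_const_nat subSS subn0 -!mulrnA; congr (_%:R).
  by rewrite !expnS expn0 muln1 !mulnA.
have zz n m : (n < z.+1)%N -> (m < z.+1)%N -> (n * m)%:R <= (z * z)%:R :> R.
  by rewrite ler_nat !ltnS; exact: leq_mul.
(* A diagonal pair gives [Y * H n] and an error [n * H n], any other pair only an error [n * m].
   Each error is at most [z ^ 2], and there are at most [z ^ 2] pairs, whence [z ^ 4]. *)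
have pair_le n m : (n < z.+1)%N -> (m < z.+1)%N -> I n -> I m ->
    \sum_(0 <= r < Y) Psi n r * Psi m r <=
    (if m == n then Y%:R * H n else 0) + (z * z)%:R.
  move=> nz mz In Im; have /andP[H0 H1] := H_bounds In.
  have [->|mn] := eqVneq m n; last first.
    rewrite add0r; apply: le_trans (ler_norm _) _.
    by rewrite eq_sym in mn; apply: le_trans (sum_Psi_cross _ _ _ _) (zz n m _ _).
  under eq_bigr do rewrite -expr2.
  apply: le_trans (sum_Psi_sqr _ In) _.
  rewrite natrD mulrDl lerD2l; apply: (@le_trans _ _ (n * n)%:R); last exact: zz.
  by rewrite -[leRHS]mulr1 ler_pM // ler_nat leq_pmulr // I_gt0.
rewrite (_ : Y%:R * G = \sum_(1 <= n < z.+1 | I n) \sum_(1 <= m < z.+1 | I m)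
    (if m == n then Y%:R * H n else 0)); last first.
  rewrite /G /sieve_total mulr_sumr big_nat_cond [RHS]big_nat_cond.
  apply: eq_bigr => n /andP[nz In]; rewrite -big_mkcondr /=.
  rewrite [RHS](eq_bigl (fun m => m == n)) => [|m]; last first.
    by case: eqP => [->|]; rewrite ?andbT ?andbF ?In.
  by rewrite big_nat1_eq nz.
apply: (@le_trans _ _ (\sum_(1 <= n < z.+1 | I n) \sum_(1 <= m < z.+1 | I m)
    ((if m == n then Y%:R * H n else 0) + (z * z)%:R))).
  rewrite big_nat_cond [leRHS]big_nat_cond; apply: ler_sum => n /andP[/andP[_ nz] In].
  rewrite exchange_big /= big_nat_cond [leRHS]big_nat_cond.
  by apply: ler_sum => m /andP[/andP[_ mz] Im]; exact: pair_le.
under eq_bigr do rewrite big_split /=.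
rewrite big_split /= lerD2l znat.
have sub (f : nat -> R) : (forall n, 0 <= f n) ->
    \sum_(1 <= n < z.+1 | I n) f n <= \sum_(1 <= n < z.+1) f n.
  by move=> f0; rewrite [leRHS](bigID I) /= lerDl sumr_ge0.
apply: le_trans (sub _ _) _; first by move=> n; rewrite sumr_ge0.
by apply: ler_sum => n _; exact: sub.
Qed.

End Sieve.

(** * Sums compared along injections, and Euler products *)

Lemma ler_sum_inj (R : numDomainType) (T U : eqType) (s : seq T) (t : seq U)
    (P : pred T) (Q : pred U) (phi : T -> U) (F : U -> R) :
    uniq s -> uniq t -> (forall y, 0 <= F y) ->
    {in s, forall x, P x -> phi x \in t /\ Q (phi x)} ->
    {in s &, forall x y, P x -> P y -> phi x = phi y -> x = y} ->
  \sum_(x <- s | P x) F (phi x) <= \sum_(y <- t | Q y) F y.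
Proof.
move=> us ut F0 phit phi_inj.
rewrite -big_filter -(big_map phi xpredT F) -[leRHS]big_filter.
set u := map _ _; have uu : uniq u.
  rewrite map_inj_in_uniq ?filter_uniq // => x y.
  by rewrite !mem_filter => /andP[Px xs] /andP[Py ys]; exact: phi_inj.
have ut' : {subset u <= seq.filter Q t}.
  move=> _ /mapP[x + ->]; rewrite !mem_filter => /andP[Px xs].
  by have [-> ->] := phit x xs Px.
rewrite [leRHS](bigID (mem u)) /= ler_wpDr ?sumr_ge0 //.
rewrite -[leRHS]big_filter le_eqVlt; apply/orP; left; apply/eqP.
apply: perm_big; apply: uniq_perm => //; first by rewrite !filter_uniq.
by move=> y; rewrite [RHS]mem_filter; have [/ut' ->|] := boolP (y \in u).
Qed.

(** Serves to bound a sum over integers by a product of two sums, once each integer is split into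
    two factors that determine it. *)
Lemma ler_sum_pair_inj (R : numDomainType) (T U V : eqType) (s : seq T)
    (t1 : seq U) (t2 : seq V) (P : pred T) (Q1 : pred U) (Q2 : pred V)
    (phi1 : T -> U) (phi2 : T -> V) (f : T -> R) (A : U -> R) (B : V -> R) :
    uniq s -> uniq t1 -> uniq t2 -> (forall y, 0 <= A y) -> (forall y, 0 <= B y) ->
    {in s, forall x, P x -> [/\ phi1 x \in t1, Q1 (phi1 x), phi2 x \in t2,
       Q2 (phi2 x) & f x <= A (phi1 x) * B (phi2 x)]} ->
    {in s &, forall x y, P x -> P y -> phi1 x = phi1 y -> phi2 x = phi2 y -> x = y} ->
  \sum_(x <- s | P x) f x <= (\sum_(y <- t1 | Q1 y) A y) * (\sum_(y <- t2 | Q2 y) B y).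
Proof.
move=> us ut1 ut2 A0 B0 phit phi_inj.
have -> : (\sum_(y <- t1 | Q1 y) A y) * (\sum_(y <- t2 | Q2 y) B y) =
    \sum_(p <- [seq (x, y) | x <- seq.filter Q1 t1, y <- seq.filter Q2 t2])
      A p.1 * B p.2.
  rewrite big_allpairs_dep -[X in X * _]big_filter -[X in _ * X]big_filter.
  by rewrite big_distrlr.
apply: (@le_trans _ _ (\sum_(x <- s | P x) A (phi1 x) * B (phi2 x))).
  rewrite big_seq_cond [leRHS]big_seq_cond.
  by apply: ler_sum => x /andP[xs Px]; have [] := phit x xs Px.
apply: (@ler_sum_inj R T _ s _ P xpredT (fun x => (phi1 x, phi2 x))
   (fun p : U * V => A p.1 * B p.2)) => //.
- by apply: allpairs_uniq; rewrite ?filter_uniq // => -[? ?] [? ?].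
- by move=> y; rewrite mulr_ge0.
- move=> x xs Px; split=> //; have [a b c d _] := phit x xs Px.
  by apply: allpairs_f; rewrite mem_filter ?a ?b ?c ?d.
by move=> x y xs ys Px Py [e1 e2]; exact: phi_inj.
Qed.

Lemma primes_partn_pow (l k : nat) : prime l -> (0 < k)%N ->
  [/\ k = (l ^ logn l k * k`_l^')%N, ~~ (l %| k`_l^')%N & (0 < k`_l^')%N].
Proof.
move=> pl k0; split; rewrite ?part_gt0 //.
  by rewrite -{1}(partnC l k0) p_part.
by rewrite -p'natE // part_pnat.
Qed.

Lemma logn_partC (l q k : nat) : prime l -> (0 < k)%N -> q != l ->
  logn q k`_l^' = logn q k.
Proof.
move=> pl k0 ql; have [ke _ k'0] := primes_partn_pow pl k0.
rewrite [in RHS]ke lognM ?expn_gt0 ?(prime_gt0 pl) //.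
by rewrite lognX (logn_prime q pl) (negbTE ql) muln0.
Qed.

Section Support.
Variables (R : realFieldType) (f : nat -> R) (g : nat -> nat -> R) (Z e0 : nat).
Hypothesis f_ge0 : forall k, 0 <= f k.
Hypothesis g_ge0 : forall l i, prime l -> 0 <= g l i.
Hypothesis f1 : f 1 <= 1.
Hypothesis fM : forall l i m, prime l -> ~~ (l %| m)%N -> (0 < m)%N ->
  f (l ^ i * m)%N <= g l i * f m.

(* With [e0 = 0] the sum runs over the [k] whose primes lie in [s], with [e0 = 1]
   over the [k] whose set of primes is exactly [s]. *)
Lemma sum_support_le (s : seq nat) : uniq s -> all prime s ->
  \sum_(1 <= k < Z.+1 | all (mem s) (primes k) && all (fun l => (e0 <= logn l k)%N) s)
     f k <= \prod_(l <- s) \sum_(e0 <= i < Z.+1) g l i.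
Proof.
elim: s => [_ _|l s IHs /= /andP[ls us] /andP[pl ps]].
  rewrite big_nil; apply: (@le_trans _ _ (\sum_(1 <= k < Z.+1 | k == 1%N) f k)).
    rewrite big_nat_cond [leRHS]big_nat_cond big_mkcond [leRHS]big_mkcond.
    apply: ler_sum => k _; rewrite /= andbT.
    case: ifP => [/andP[/andP[k0 kZ] kn]|_]; last by case: ifP.
    suff -> : k == 1%N by rewrite k0 kZ.
    rewrite eqn_leq k0 andbT leqNgt; apply/negP => k1.
    have := pdiv_prime k1 => pp; have := allP kn (pdiv k).
    by rewrite mem_primes pp k0 pdiv_dvd => /(_ isT).
  by rewrite big_nat1_eq; case: ifP.
rewrite big_cons; apply: le_trans _ (ler_wpM2l _ (IHs us ps)); last first.
  by apply: sumr_ge0 => i _; exact: g_ge0.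
pose P k := [&& all (mem (l :: s)) (primes k), (e0 <= logn l k)%N &
  all (fun l => (e0 <= logn l k)%N) s].
pose Q k := all (mem s) (primes k) && all (fun l => (e0 <= logn l k)%N) s.
apply: (@ler_sum_pair_inj R nat nat nat (index_iota 1 Z.+1) (index_iota e0 Z.+1)
  (index_iota 1 Z.+1) P xpredT Q (fun k => logn l k) (fun k => (k`_l^')%N) f
  (fun i => g l i) f); rewrite ?iota_uniq //.
- by move=> i; exact: g_ge0.
- move=> k; rewrite mem_index_iota => /andP[k0 kZ] /andP[kp /andP[lk sk]].
  have [ke lNk k'0] := primes_partn_pow pl k0.
  split=> //.
  + rewrite mem_index_iota lk /=; apply: leq_ltn_trans kZ.
    exact: ltnW (ltn_logl _ _).
  + by rewrite mem_index_iota k'0 ltnS (leq_trans (dvdn_leq _ (dvdn_part _ _))).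
  + apply/andP; split.
      apply/allP => q; rewrite primes_part mem_filter => /andP[].
      rewrite !inE => ql qk.
      by have /allP/(_ q qk) := kp; rewrite /= inE (negbTE ql).
    apply/allP => q qs; have /= := allP sk q qs.
    by rewrite logn_partC //; apply: contraNneq ls => <-.
  + by rewrite {1}ke; exact: fM.
move=> x y; rewrite !mem_index_iota => /andP[x0 _] /andP[y0 _] _ _ e1 e2.
have [-> _ _] := primes_partn_pow pl x0; have [-> _ _] := primes_partn_pow pl y0.
by rewrite e1 e2.
Qed.

End Support.

(** * Radicals and numbers of divisors *)

Definition rad (k : nat) : nat := (\prod_(l <- primes k) l)%N.

Lemma rad_gt0 k : (0 < rad k)%N.
Proof.
rewrite /rad big_seq prodn_cond_gt0 // => l.
by rewrite mem_primes => /andP[/prime_gt0].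
Qed.

Lemma primes_rad k : primes (rad k) = primes k.
Proof.
apply: (irr_sorted_eq ltn_trans ltnn); rewrite ?sorted_primes // => q.
rewrite mem_primes rad_gt0 /=; apply/andP/idP => [[pq]|qk]; last first.
  split; first by move: qk; rewrite mem_primes => /andP[].
  by rewrite /rad (big_rem q) //= dvdn_mulr.
rewrite /rad Euclid_dvd_prod // big_has => /hasP[l lk ql].
have pl : prime l by move: lk; rewrite mem_primes => /andP[].
by move: ql; rewrite dvdn_prime2 // => /eqP ->.
Qed.

Lemma rad_dvd k : (0 < k)%N -> (rad k %| k)%N.
Proof.
move=> k0; rewrite {2}[k]prod_prime_decomp // prime_decompE big_map /= /rad.
rewrite big_seq [X in (_ %| X)%N]big_seq.
elim/big_ind2: _ => // [x1 x2 y1 y2|l]; first exact: dvdn_mul.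
by rewrite -logn_gt0 => l0; rewrite dvdn_exp.
Qed.

Lemma squarefree_rad k : squarefree (rad k).
Proof. by rewrite /squarefree primes_rad. Qed.

Definition ndiv (k : nat) : nat := size (divisors k).

(** A divisor of [l * m] is either [l] times a divisor of [m], or prime to [l] and then itself a
    divisor of [m]. *)
Lemma ndiv_mul_prime l m : prime l -> (0 < m)%N -> (ndiv (l * m) <= 2 * ndiv m)%N.
Proof.
move=> pl m0; have l0 := prime_gt0 pl.
rewrite mul2n -addnn /ndiv -[X in (_ <= _ + X)%N](size_map (muln l)) -size_cat.
apply: uniq_leq_size; first exact: divisors_uniq.
move=> d; rewrite -dvdn_divisors ?muln_gt0 ?l0 // mem_cat => dlm.
have [/dvdnP[d' def]|lNd] := boolP (l %| d)%N; apply/orP; [right|left].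
  apply/mapP; exists d'; last by rewrite def mulnC.
  by move: dlm; rewrite def mulnC dvdn_pmul2l // dvdn_divisors.
rewrite -dvdn_divisors //; move: dlm; rewrite Gauss_dvdr //.
by rewrite coprime_sym prime_coprime.
Qed.

Lemma ndiv_mul_pow l i m : prime l -> (0 < m)%N ->
  (ndiv (l ^ i * m) <= 2 ^ i * ndiv m)%N.
Proof.
move=> pl m0; elim: i => [|i IHi]; first by rewrite !mul1n.
rewrite !expnS -!mulnA; apply: leq_trans (ndiv_mul_prime pl _) _.
  by rewrite muln_gt0 expn_gt0 prime_gt0.
by rewrite leq_mul2l IHi.
Qed.

(** Used with [b = 6 * a]: modulo a prime dividing [a], the product [r * (a * r + 1)] vanishes in
    one class only instead of two. *)
Definition sieving_modulus (b n : nat) : bool := squarefree n && coprime n b.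

(** * Lower bound for the Selberg denominator *)

Section Sums.
Variable R : realFieldType.

Lemma geometric_le (x : R) n : 0 <= x < 1 ->
  \sum_(1 <= i < n.+1) x ^+ i <= x / (1 - x).
Proof.
case/andP=> x0 x1.
rewrite (_ : \sum_(1 <= i < n.+1) x ^+ i = (x - x ^+ n.+1) / (1 - x)).
  by rewrite ler_pM2r ?invr_gt0 ?subr_gt0 // gerBl exprn_ge0.
elim: n => [|n IHn]; first by rewrite big_geq // expr1 subrr mul0r.
rewrite big_nat_recr //= IHn !exprS.
by field; lra.
Qed.

Definition harm (n : nat) : R := \sum_(1 <= k < n.+1) k%:R^-1.

Lemma harm_step s :
  harm (2 ^ s.+1) = harm (2 ^ s) + \sum_((2 ^ s).+1 <= k < (2 ^ s.+1).+1) k%:R^-1.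
Proof.
rewrite /harm (@big_cat_nat _ _ _ (2 ^ s).+1) //=.
by rewrite ltnS leq_exp2l.
Qed.

(** Each dyadic block from [2 ^ s + 1] to [2 ^ s.+1] contributes between 1/2 and 1. *)
Lemma harm_pow2 s : s%:R / 2 <= harm (2 ^ s) <= s%:R + 1.
Proof.
elim: s => [|s /andP[IH1 IH2]].
  by rewrite /harm big_nat1 invr1 mul0r add0r; lra.
rewrite harm_step -[s.+1%:R]natr1.
have p0 : 0 < (2 ^ s)%:R :> R by rewrite ltr0n expn_gt0.
have cst (c : R) : \sum_((2 ^ s).+1 <= k < (2 ^ s.+1).+1) c = c * (2 ^ s)%:R.
  by rewrite sumr_const_nat mulr_natr subSS expnS mul2n -addnn addnK.
have : \sum_((2 ^ s).+1 <= k < (2 ^ s.+1).+1) (2 ^ s.+1)%:R^-1 <=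
    \sum_((2 ^ s).+1 <= k < (2 ^ s.+1).+1) k%:R^-1 :> R.
  apply: ler_sum_nat => k /andP[k1 k2].
  have k0 : (0 < k)%N by apply: leq_trans k1.
  by rewrite lef_pV2 ?posrE ?ltr0n ?ler_nat ?expn_gt0.
have : \sum_((2 ^ s).+1 <= k < (2 ^ s.+1).+1) k%:R^-1 <=
    \sum_((2 ^ s).+1 <= k < (2 ^ s.+1).+1) (2 ^ s)%:R^-1 :> R.
  apply: ler_sum_nat => k /andP[k1 k2].
  have k0 : (0 < k)%N by apply: leq_trans k1.
  by rewrite lef_pV2 ?posrE ?ltr0n ?ler_nat ?expn_gt0 // ltnW.
rewrite !cst mulVf ?gt_eqF //.
rewrite (_ : (2 ^ s.+1)%:R^-1 * (2 ^ s)%:R = 1 / 2); first by lra.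
by rewrite expnS natrM; field; rewrite gt_eqF.
Qed.

(* [2 / (l - 2)] is the sum of [(2 / l) ^ i] over [i > 0] and [ndiv (l ^ i * m)] is
   at most [2 ^ i * ndiv m]: collect the [k] on the left by their radical. *)
Lemma sieve_total_ge_ndiv (b z : nat) : (6 %| b)%N ->
  \sum_(1 <= k < z.+1 | coprime k b) (ndiv k)%:R / k%:R <=
  sieve_total R (sieving_modulus b) z.
Proof.
move=> b6.
pose f k : R := (ndiv k)%:R / k%:R.
have f0 k : 0 <= f k by rewrite divr_ge0.
rewrite /sieve_total.
have fibre k : (1 <= k < z.+1)%N -> coprime k b ->
    f k = \sum_(1 <= n < z.+1 | sieving_modulus b n) (if n == rad k then f k else 0).
  case/andP=> k0 kz kb; rewrite -big_mkcondr /=.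
  rewrite (eq_bigl (fun n => n == rad k)) => [|n].
    rewrite big_nat1_eq rad_gt0 ltnS (leq_trans (dvdn_leq _ (rad_dvd k0))) //.
  case: eqP => [->|]; rewrite ?andbF ?andbT // /sieving_modulus squarefree_rad /=.
  exact: coprime_dvdl (rad_dvd k0) kb.
rewrite big_nat_cond (eq_bigr (fun k => \sum_(1 <= n < z.+1 | sieving_modulus b n)
    (if n == rad k then f k else 0))); last by move=> k /andP[]; exact: fibre.
rewrite -big_nat_cond exchange_big /=.
apply: ler_sum => n /andP[_ nb].
have n4 l : l \in primes n -> [/\ prime l & (4 <= l)%N].
  rewrite mem_primes => /and3P[pl n0 ln]; split=> //.
  have lb : coprime l b by exact: coprime_dvdl ln nb.
  case: l pl lb {ln} => [|[|[|[|l]]]] //= _; rewrite ?prime_coprime //.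
    by rewrite (dvdn_trans _ b6).
  by rewrite (dvdn_trans _ b6).
pose g l i : R := (2 / l%:R) ^+ i.
apply: (@le_trans _ _ (\prod_(l <- primes n) \sum_(1 <= i < z.+1) g l i)); last first.
  rewrite big_seq [leRHS]big_seq; apply: ler_prod => l /n4[pl l4].
  have {}l4 : 4 <= l%:R :> R by rewrite (ler_nat _ 4).
  apply/andP; split; first by apply: sumr_ge0 => i _; rewrite exprn_ge0 // divr_ge0.
  apply: le_trans (geometric_le _ _) _.
    by rewrite divr_ge0 //= ltr_pdivrMr; lra.
  suff -> : 2 / l%:R / (1 - 2 / l%:R) = sieve_weight R l by [].
  by rewrite /sieve_weight; field; lra.
apply: le_trans _ (@sum_support_le R f g z 1 f0 _ _ _ (primes n) (primes_uniq n) _).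
- rewrite big_mkcond [leRHS]big_mkcond; apply: ler_sum => k _.
  case: ifP => [_|_]; last by case: ifP.
  case: eqP => [nk|_]; last by case: ifP.
  have pk : primes k = primes n by rewrite nk primes_rad.
  have -> : all (mem (primes n)) (primes k) by rewrite pk; apply/allP.
  rewrite (_ : all _ (primes n)) //; apply/allP => l; rewrite -pk.
  by rewrite -logn_gt0.
- by move=> l i _; rewrite exprn_ge0 // divr_ge0.
- by rewrite /f /ndiv divr1.
- move=> l i m pl lm m0; rewrite /f /g.
  have -> : (2 / l%:R) ^+ i * ((ndiv m)%:R / m%:R) =
      (2 ^ i * ndiv m)%:R / (l ^ i * m)%:R :> R.
    by rewrite !natrM !natrX expr_div_n invfM mulrACA.
  by rewrite ler_wpM2r ?invr_ge0 // ler_nat ndiv_mul_pow.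
by apply/allP => l /n4[].
Qed.

(** Expanding the square gives terms [1 / (i * j)], and each [k = i * j] arises from at most
    [ndiv k] pairs. *)
Lemma ndiv_sum_ge (b Z : nat) :
  (\sum_(1 <= k < Z.+1 | coprime k b) k%:R^-1 : R) ^+ 2 <=
  \sum_(1 <= k < (Z * Z).+1 | coprime k b) (ndiv k)%:R / k%:R.
Proof.
apply: (@le_trans _ _ (\sum_(1 <= k < (Z * Z).+1 | coprime k b)
   \sum_(1 <= j < Z.+1 | (j %| k)%N && coprime j b) k%:R^-1)); last first.
  rewrite big_nat_cond [leRHS]big_nat_cond; apply: ler_sum => k /andP[/andP[k0 _] _].
  rewrite big_const_seq iter_addr_0 -[leLHS]mulr_natl.
  rewrite ler_wpM2r ?invr_ge0 // ler_nat -size_filter /ndiv.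
  apply: uniq_leq_size; first by rewrite filter_uniq ?iota_uniq.
  by move=> j; rewrite mem_filter -dvdn_divisors // => /andP[/andP[]].
rewrite expr2 big_distrlr /=.
rewrite [leRHS](exchange_big_dep (fun j => coprime j b)) /=; last first.
  by move=> ? ? _ /andP[].
rewrite big_nat_cond [leRHS]big_nat_cond; apply: ler_sum => j /andP[/andP[j0 jZ] jb].
have inv0 (k : nat) : 0 <= k%:R^-1 :> R by rewrite invr_ge0.
rewrite (eq_bigr (fun i => (j * i)%:R^-1)) => [|i _]; last by rewrite natrM invfM.
apply: (@ler_sum_inj R _ _ (index_iota 1 Z.+1) (index_iota 1 (Z * Z).+1) _ _ (muln j)
  (fun k => k%:R^-1)); rewrite ?iota_uniq //.
  move=> i; rewrite !mem_index_iota => /andP[i0 iZ] ib.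
  by rewrite muln_gt0 j0 i0 ltnS leq_mul // coprimeMl ib jb dvdn_mulr.
by move=> x y _ _ _ _ /eqP; rewrite eqn_pmul2l // => /eqP.
Qed.

(** Equal to [b / totient b] for [b > 0], as the product of [1 / (1 - 1 / l)]. *)
Definition mertens (b : nat) : R := \prod_(l <- primes b) (l%:R / (l%:R - 1)).

Let primesR b l : l \in primes b -> 2 <= l%:R :> R.
Proof. by rewrite mem_primes => /andP[/prime_gt1 pl _]; rewrite (ler_nat _ 2). Qed.

Lemma mertens_ge1 b : 1 <= mertens b.
Proof.
rewrite /mertens big_seq; elim/big_ind: _ => // [x y x1 y1|l /primesR l2].
  by rewrite mulr_ege1.
by rewrite ler_pdivlMr; lra.
Qed.

(** Each [k] factors into a part built from the primes of [b] and a part coprime to [b]; the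
    inverses of the former sum to at most the Euler product [mertens b]. *)
Lemma harm_le_coprime (b Z : nat) : (0 < b)%N ->
  harm Z <= mertens b * \sum_(1 <= k < Z.+1 | coprime k b) k%:R^-1.
Proof.
move=> b0; pose s := primes b.
have ps : all prime s by apply/allP => l; rewrite mem_primes => /andP[].
pose f k : R := k%:R^-1.
pose g (l i : nat) : R := (l%:R^-1) ^+ i.
pose P k := all (mem s) (primes k) && all (fun l => (0 <= logn l k)%N) s.
have sup : \sum_(1 <= k < Z.+1 | P k) f k <= mertens b.
  apply: le_trans (@sum_support_le R f g Z 0 _ _ _ _ s (primes_uniq b) ps) _.
  - by move=> k; rewrite invr_ge0.
  - by move=> l i _; rewrite exprn_ge0 // invr_ge0.
  - by rewrite /f invr1.
  - by move=> l i m *; rewrite /f /g natrM natrX invfM exprVn.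
  rewrite /mertens big_seq [leRHS]big_seq; apply: ler_prod => l lb.
  have l2 := primesR lb.
  rewrite sumr_ge0 => [|i _]; last by rewrite exprn_ge0 // invr_ge0.
  rewrite /= big_ltn // /g expr0; apply: (@le_trans _ _ (1 + l%:R^-1 / (1 - l%:R^-1))).
    rewrite lerD2l; apply: geometric_le.
    by rewrite invr_ge0 ler0n invf_lt1 //; lra.
  suff -> : 1 + l%:R^-1 / (1 - l%:R^-1) = l%:R / (l%:R - 1) :> R by [].
  by field; lra.
have c0 : 0 <= \sum_(1 <= k < Z.+1 | coprime k b) k%:R^-1 :> R.
  by apply: sumr_ge0 => k _; rewrite invr_ge0.
apply: le_trans _ (ler_wpM2r c0 sup).
apply: (@ler_sum_pair_inj R nat nat nat (index_iota 1 Z.+1) (index_iota 1 Z.+1)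
  (index_iota 1 Z.+1) xpredT P (fun k => coprime k b)
  (fun k => (k`_\pi(b))%N) (fun k => (k`_\pi(b)^')%N) f f f); rewrite ?iota_uniq //.
- by move=> k; rewrite invr_ge0.
- by move=> k; rewrite invr_ge0.
- move=> k; rewrite mem_index_iota => /andP[k0 kZ] _.
  have le_part (pi : nat_pred) : (1 <= k`_pi < Z.+1)%N.
    by rewrite part_gt0 ltnS (leq_trans (dvdn_leq _ (dvdn_part _ _))).
  split; rewrite ?mem_index_iota ?le_part //.
  + rewrite /P primes_part; apply/andP; split; last by apply/allP.
    by apply/allP => l; rewrite mem_filter => /andP[].
  + by rewrite coprime_sym coprime_pi' ?part_pnat.
  + by rewrite /f -invfM -natrM partnC.
move=> x y; rewrite !mem_index_iota => /andP[x0 _] /andP[y0 _] _ _ e1 e2.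
by rewrite -(partnC \pi(b) x0) -(partnC \pi(b) y0) e1 e2.
Qed.

(* The hypothesis [6 %| b] keeps the primes 2 and 3 out of the sieve, where the
   weight [2 / (l - 2)] would exceed 1 or be undefined. *)
Lemma sieve_total_ge (b Z : nat) : (6 %| b)%N -> (0 < b)%N ->
  (harm Z / mertens b) ^+ 2 <= sieve_total R (sieving_modulus b) (Z * Z).
Proof.
move=> b6 b0; apply: le_trans (sieve_total_ge_ndiv _ b6).
apply: le_trans _ (ndiv_sum_ge b Z).
have m1 := mertens_ge1 b.
have h0 : 0 <= harm Z by apply: sumr_ge0 => k _; rewrite invr_ge0.
rewrite ler_sqr ?nnegrE ?divr_ge0 //; first last.
- by apply: sumr_ge0 => k _; rewrite invr_ge0.
- by apply: le_trans m1.
by rewrite ler_pdivrMr ?(lt_le_trans ltr01) // mulrC harm_le_coprime.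
Qed.

End Sums.

Lemma perm_primes_powM l i e : prime l -> (0 < e)%N -> ~~ (l %| e)%N ->
  perm_eq (primes (l ^ i.+1 * e)) (l :: primes e).
Proof.
move=> pl e0 le; apply: uniq_perm; rewrite /= ?primes_uniq ?andbT //.
  by rewrite mem_primes pl e0.
have li0 : (0 < l ^ i.+1)%N by rewrite expn_gt0 prime_gt0.
by move=> q; rewrite primesM // primesX // (primes_prime pl) !inE.
Qed.

(** * Mean square of n / totient n *)

Section Mertens.
Variable R : realFieldType.

(** Each prime of [m * n] divides [m] or [n], and repeating a factor does no harm since all factors
    are at least 1. *)
Lemma mertens_mul (m n : nat) : (0 < m)%N -> (0 < n)%N ->
  mertens R (m * n) <= mertens R m * mertens R n.
Proof.
move=> m0 n0; rewrite {1}/mertens (bigID (mem (primes m))) /=.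
pose F (l : nat) : R := l%:R / (l%:R - 1).
have F1 b l : l \in primes b -> 1 <= F l.
  rewrite mem_primes => /andP[/prime_gt1 pl _].
  have : 2 <= l%:R :> R by rewrite (ler_nat _ 2).
  by move=> l2; rewrite /F ler_pdivlMr; lra.
have F0 b l : l \in primes b -> 0 <= F l.
  by move=> lb; apply: le_trans (F1 b l lb).
have prod0 b (P : pred nat) : 0 <= \prod_(l <- primes b | P l) F l.
  by rewrite big_seq_cond prodr_ge0 // => l /andP[/F0].
have prod1 b (P : pred nat) : 1 <= \prod_(l <- primes b | P l) F l.
  rewrite big_seq_cond; elim/big_ind: _ => // [x y|l /andP[/F1 //]].
  exact: mulr_ege1.
rewrite ler_pM ?prod0 //.
  rewrite -big_filter le_eqVlt; apply/orP; left; apply/eqP; apply: perm_big.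
  apply: uniq_perm; rewrite ?filter_uniq ?primes_uniq // => l.
  by rewrite mem_filter primesM //; case: (l \in primes m).
rewrite [leRHS](bigID (mem (primes m))) /=.
apply: (@le_trans _ _ (\prod_(l <- primes n | l \notin primes m) F l)).
  rewrite -big_filter -[leRHS]big_filter.
  rewrite le_eqVlt; apply/orP; left; apply/eqP; apply: perm_big.
  apply: uniq_perm; rewrite ?filter_uniq ?primes_uniq // => l.
  by rewrite !mem_filter primesM //; case: (l \in primes m).
by rewrite ler_peMl.
Qed.

(** Chosen so that [1 + mertens_gap l] is the square of the factor of [mertens] at [l]. Thus
    [mertens a ^ 2] is the sum of [gap_prod e] over the squarefree divisors [e] of [a]. *)
Definition mertens_gap (l : nat) : R := (l%:R / (l%:R - 1)) ^+ 2 - 1.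
Definition gap_prod (e : nat) : R := \prod_(l <- primes e) mertens_gap l.

Lemma mertens_gap_ge0 l : prime l -> 0 <= mertens_gap l.
Proof.
move/prime_gt1 => l1; have l2 : 2 <= l%:R :> R by rewrite (ler_nat _ 2).
by rewrite subr_ge0 exprn_ege1 // ler_pdivlMr; lra.
Qed.

Lemma gap_prod_ge0 e : 0 <= gap_prod e.
Proof.
rewrite /gap_prod big_seq prodr_ge0 // => l; rewrite mem_primes => /andP[pl _].
exact: mertens_gap_ge0.
Qed.

Lemma gap_prod_powM l i e : prime l -> (0 < e)%N -> ~~ (l %| e)%N ->
  gap_prod (l ^ i.+1 * e) = mertens_gap l * gap_prod e.
Proof.
move=> pl e0 le.
by rewrite /gap_prod (perm_big _ (perm_primes_powM i pl e0 le)) big_cons.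
Qed.

(** Expanding the product gives one term for each subset of [s], hence for each divisor of the
    squarefree product. The induction splits the divisors according to divisibility by [l]. *)
Lemma prod_gap_le (s : seq nat) : uniq s -> all prime s ->
  \prod_(l <- s) (1 + mertens_gap l) <=
  \sum_(e <- divisors (\prod_(l <- s) l)) gap_prod e.
Proof.
elim: s => [_ _|l s IHs /= /andP[ls us] /andP[pl ps]].
  by rewrite !big_nil big_seq1 /gap_prod big_nil.
rewrite !big_cons; set N := (\prod_(j <- s) j)%N.
have N0 : (0 < N)%N.
  by rewrite /N big_seq prodn_cond_gt0 // => j /(allP ps)/prime_gt0.
have lN0 : (0 < l * N)%N by rewrite muln_gt0 prime_gt0.
have lN : ~~ (l %| N)%N.
  rewrite Euclid_dvd_prod // big_has; apply/hasPn => j js.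
  rewrite dvdn_prime2 ?(allP ps _ js) //; apply: contraNneq ls => -> //.
have l0 := mertens_gap_ge0 pl.
apply: le_trans (ler_wpM2l _ (IHs us ps)) _; first by rewrite addr_ge0.
rewrite mulrDl mul1r addrC [leRHS](bigID (fun e => l %| e)%N) /=; apply: lerD.
  rewrite mulr_sumr big_seq.
  rewrite [leLHS](eq_bigr (fun e => gap_prod (l * e))) => [|e]; last first.
    rewrite -dvdn_divisors // => eN.
    rewrite -{2}[l]expn1 gap_prod_powM ?(dvdn_gt0 N0) //.
    by apply: contra lN => /dvdn_trans; apply.
  apply: ler_sum_inj; rewrite ?divisors_uniq //; first exact: gap_prod_ge0.
    move=> e _; rewrite -!dvdn_divisors // => eN.
    by rewrite dvdn_pmul2l ?prime_gt0 // dvdn_mulr.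
  by move=> x y _ _ _ _ /eqP; rewrite eqn_pmul2l ?prime_gt0 // => /eqP.
rewrite big_seq; apply: (@ler_sum_inj _ _ _ _ _ _ _ id) => //.
- exact: divisors_uniq.
- exact: divisors_uniq.
- exact: gap_prod_ge0.
move=> e _; rewrite -!dvdn_divisors // => eN.
split; first exact: dvdn_mull.
by apply: contra lN => /dvdn_trans; apply.
Qed.

Lemma mertens_sqr_le (a w : nat) : (0 < a <= w)%N ->
  mertens R a ^+ 2 <= \sum_(1 <= e < w.+1 | (e %| a)%N) gap_prod e.
Proof.
case/andP=> a0 aw; have pa : all prime (primes a).
  by apply/allP => l; rewrite mem_primes => /andP[].
rewrite /mertens -prodrXl.
rewrite (eq_bigr (fun l => 1 + mertens_gap l)) => [|l _]; last first.
  by rewrite /mertens_gap addrCA subrr addr0.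
apply: le_trans (prod_gap_le (primes_uniq a) pa) _.
rewrite big_seq; apply: (@ler_sum_inj _ _ _ _ _ _ _ id) => //.
- exact: divisors_uniq.
- exact: iota_uniq.
- exact: gap_prod_ge0.
move=> e _; rewrite -dvdn_divisors ?rad_gt0 // => ea.
have {}ea : (e %| a)%N := dvdn_trans ea (rad_dvd a0).
by rewrite mem_index_iota ltnS (dvdn_gt0 a0 ea) (leq_trans (dvdn_leq a0 ea) aw).
Qed.

Lemma prod_telescope n :
  \prod_(2 <= j < n.+2) (j%:R ^+ 2 / (j%:R ^+ 2 - 1)) = n.+1%:R * 2 / (n.+2%:R) :> R.
Proof.
elim: n => [|n IHn]; first by rewrite big_geq // mul1r divff ?pnatr_eq0.
rewrite big_nat_recr //= IHn.
have -> : n.+1%:R = n%:R + 1 :> R by rewrite natr1.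
have -> : n.+2%:R = n%:R + 2 :> R by rewrite -addn2 natrD.
have -> : n.+3%:R = n%:R + 3 :> R by rewrite -addn3 natrD.
have n0 : 0 <= n%:R :> R by [].
by field; rewrite !gt_eqF //=; nra.
Qed.

(* The Euler factor at [l] is at most [1 + 9 / (l ^ 2 - 1)], hence at most
   [(l ^ 2 / (l ^ 2 - 1)) ^ 9], and the product telescopes to [2 ^ 9]. *)
Lemma gap_prod_sum_le (w : nat) :
  \sum_(1 <= e < w.+1) gap_prod e / e%:R <= 512.
Proof.
pose s := seq.filter prime (index_iota 2 w.+2).
have us : uniq s by rewrite filter_uniq ?iota_uniq.
have ps : all prime s by apply/allP => l; rewrite mem_filter => /andP[].
pose f e := gap_prod e / e%:R.
pose g (l i : nat) : R := if i is 0%N then 1 else mertens_gap l * (l%:R^-1) ^+ i.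
have f0 e : 0 <= f e by rewrite divr_ge0 ?gap_prod_ge0.
have g0 l i : prime l -> 0 <= g l i.
  move=> pl; case: i => //= i.
  by rewrite mulr_ge0 ?mertens_gap_ge0 ?exprn_ge0 ?invr_ge0.
have f1 : f 1 <= 1 by rewrite /f /gap_prod big_nil divr1.
have fM l i m : prime l -> ~~ (l %| m)%N -> (0 < m)%N ->
    f (l ^ i * m)%N <= g l i * f m.
  move=> pl lm m0; rewrite /f /g; case: i => [|i]; first by rewrite !mul1n mul1r.
  by rewrite gap_prod_powM // natrM natrX invfM exprVn mulrACA.
pose h (j : nat) : R := j%:R ^+ 2 / (j%:R ^+ 2 - 1).
have h1 j : (2 <= j)%N -> 1 <= h j.
  move=> j2; have {}j2 : 2 <= j%:R :> R by rewrite (ler_nat _ 2).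
  by rewrite /h ler_pdivlMr; nra.
have sup := @sum_support_le R f g w 0 f0 g0 f1 fM s us ps.
apply: (@le_trans _ _ (\prod_(l <- s) h l ^+ 9)); last first.
  apply: (@le_trans _ _ (\prod_(2 <= j < w.+2) h j ^+ 9)).
    rewrite big_filter [leRHS](bigID prime) /= ler_peMr //.
      rewrite big_nat_cond prodr_ge0 // => j /andP[/andP[/h1 hj _] _].
      by rewrite exprn_ge0 // (le_trans ler01).
    rewrite big_nat_cond; elim/big_ind: _ => // [x y|j /andP[/andP[/h1 hj _] _]].
      exact: mulr_ege1.
    exact: exprn_ege1.
  rewrite prodrXl prod_telescope.
  have w0 : 0 <= w%:R :> R by [].
  have -> : w.+1%:R = w%:R + 1 :> R by rewrite natr1.
  have -> : w.+2%:R = w%:R + 2 :> R by rewrite -addn2 natrD.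
  have -> : 512 = 2 ^+ 9 :> R by rewrite -natrX.
  have q0 : 0 <= (w%:R + 1) * 2 / (w%:R + 2) :> R.
    by apply: divr_ge0; lra.
  rewrite lerXn2r ?nnegrE //.
  by rewrite ler_pdivrMr; lra.
apply: le_trans (le_trans sup _).
  rewrite big_nat_cond [leRHS]big_nat_cond le_eqVlt; apply/orP; left; apply/eqP.
  apply: eq_bigl => e; rewrite andbT.
  case: (boolP (1 <= e < w.+1)%N) => //= /andP[e0 ew].
  apply/esym/andP; split; last by apply/allP.
  apply/allP => l; rewrite mem_primes => /and3P[pl _ le].
  rewrite /= mem_filter pl mem_index_iota prime_gt1 // ltnS ltnW // ltnS.
  by rewrite (leq_trans (dvdn_leq e0 le)).
rewrite big_seq [leRHS]big_seq; apply: ler_prod => l ls.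
have pl := allP ps l ls.
have l2 : 2 <= l%:R :> R by rewrite (ler_nat _ 2) prime_gt1.
rewrite sumr_ge0 => [|i _]; last exact: g0.
rewrite big_ltn //=.
rewrite (eq_big_nat _ _ (F2 := fun i => mertens_gap l * (l%:R^-1) ^+ i)); last by case.
rewrite -mulr_sumr.
apply: (@le_trans _ _ (1 + mertens_gap l * (l%:R^-1 / (1 - l%:R^-1)))).
  rewrite lerD2l ler_wpM2l ?mertens_gap_ge0 //; apply: geometric_le.
  by rewrite invr_ge0 ler0n invf_lt1 //; lra.
rewrite /h /mertens_gap; move: (l%:R) l2 => x x2.
pose y := (x ^+ 2 - 1)^-1.
have y0 : 0 <= y by rewrite invr_ge0; nra.
have -> : x ^+ 2 / (x ^+ 2 - 1) = 1 + y.
  by rewrite /y; field; rewrite gt_eqF //; nra.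
(* The goal left first is Bernoulli's inequality for the exponent 9. *)
apply: (@le_trans _ _ (1 + 9 * y)); last first.
  rewrite !exprS expr0 mulr1; nra.
rewrite lerD2l -subr_ge0.
(* The factor [x - 2] shows that 9 is the least admissible constant: equality holds at [l = 2]. *)
have -> : 9 * y - ((x / (x - 1)) ^+ 2 - 1) * (x^-1 / (1 - x^-1)) =
   (x - 2) * (7 * x - 5) / ((x - 1) ^+ 3 * (x + 1)).
  rewrite /y; field; rewrite !gt_eqF //; nra.
by rewrite divr_ge0 // mulr_ge0 ?exprn_ge0; lra.
Qed.

(** After exchanging summations, the multiples [a = e * k] of [e] contribute at most [harm w / e].
    The sieve bound for a given [a] carries the factor [mertens a ^ 2 / a], so this controls its sum
    over [a]. *)
Lemma sum_mertens_sqr_le (w : nat) :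
  \sum_(1 <= a < w.+1) mertens R a ^+ 2 / a%:R <= 512 * harm R w.
Proof.
apply: (@le_trans _ _ (\sum_(1 <= a < w.+1) \sum_(1 <= e < w.+1 | (e %| a)%N)
   gap_prod e / a%:R)).
  apply: ler_sum_nat => a aw; rewrite -mulr_suml ler_wpM2r ?invr_ge0 //.
  by rewrite mertens_sqr_le // -ltnS.
rewrite (exchange_big_dep xpredT) //=.
have H0 : 0 <= harm R w by apply: sumr_ge0 => k _; rewrite invr_ge0.
apply: le_trans _ (ler_wpM2r H0 (gap_prod_sum_le w)).
rewrite mulr_suml; apply: ler_sum_nat => e /andP[e0 ew].
rewrite -mulr_sumr -mulrA ler_wpM2l ?gap_prod_ge0 // /harm mulr_sumr.
rewrite big_seq_cond.
rewrite (eq_bigr (fun a => e%:R^-1 * ((a %/ e)%N)%:R^-1)); last first.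
  by move=> a /andP[_ ea]; rewrite -invfM -natrM mulnC divnK.
rewrite -big_seq_cond.
apply: (@ler_sum_inj _ _ _ _ _ _ _ (divn^~ e) (fun k => e%:R^-1 * k%:R^-1)).
- exact: iota_uniq.
- exact: iota_uniq.
- by move=> k; rewrite mulr_ge0 ?invr_ge0.
- move=> a; rewrite !mem_index_iota => /andP[a0 aw] ea; split=> //.
  rewrite divn_gt0 // dvdn_leq //=.
  by apply: leq_ltn_trans aw; exact: leq_div.
move=> x y _ _ ex ey exy.
by rewrite -(divnK ex) -(divnK ey) exy.
Qed.

End Mertens.

(** * Primes [p] with [p - 1] smooth *)

Section Chebyshev.
Local Open Scope nat_scope.

(** The coefficient is the product of the quotients of [m.*2 - i] by [m - i] for [i < m], each at
    least 2. *)
Lemma central_bin_ge m : 2 ^ m <= 'C(m.*2, m).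
Proof.
rewrite -(leq_pmul2r (fact_gt0 m)) bin_ffact -ffactnn !ffact_prod.
rewrite -[X in 2 ^ X]card_ord -prod_nat_const -big_split /=.
by apply: leq_prod => i _; lia.
Qed.

(** In Legendre's formula the term [m.*2 %/ p ^ k - 2 * (m %/ p ^ k)] is 0 or 1, and it is 0 once
    [p ^ k] exceeds [m.*2]. *)
Lemma pfactor_central_bin_le p m : prime p -> 0 < m ->
  p ^ logn p 'C(m.*2, m) <= m.*2.
Proof.
move=> pp m0; have m20 : 0 < m.*2 by rewrite double_gt0.
apply: leq_trans (trunc_logP (prime_gt1 pp) m20).
rewrite leq_exp2l ?prime_gt1 //.
have bin0 : 0 < 'C(m.*2, m) by rewrite bin_gt0 -addnn leq_addr.
have m_le : m <= m.*2 by rewrite -addnn leq_addr.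
have := congr1 (logn p) (bin_fact m_le).
rewrite lognM ?muln_gt0 ?fact_gt0 // lognM ?fact_gt0 //.
rewrite (_ : m.*2 - m = m); last by rewrite -addnn addnK.
set t := trunc_log p m.*2.
have lt_t k : t < k -> m.*2 < p ^ k.
  move=> tk; apply: leq_trans (trunc_log_ltn _ (prime_gt1 pp)) _.
  by rewrite leq_exp2l // prime_gt1.
have sum_t n : n <= m.*2 -> logn p n`! = \sum_(1 <= k < t.+1) n %/ p ^ k.
  move=> nm; rewrite logn_fact //.
  have [nt|tn] := leqP n t.
    rewrite [RHS](@big_cat_nat _ _ _ n.+1) //= [X in _ = _ + X]big1_seq ?addn0 //.
    move=> k /andP[_]; rewrite mem_index_iota => /andP[nk _]; rewrite divn_small //.
    by apply: ltn_trans nk _; rewrite ltn_expl ?prime_gt1.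
  rewrite (@big_cat_nat _ _ _ t.+1) //=; last exact: ltnW.
  rewrite [X in _ + X = _]big1_seq ?addn0 //.
  move=> k /andP[_]; rewrite mem_index_iota => /andP[tk _]; rewrite divn_small //.
  by apply: leq_ltn_trans nm (lt_t _ tk).
rewrite !sum_t //.
move=> eqn.
have {}eqn : logn p 'C(m.*2, m) + \sum_(1 <= i < t.+1) 2 * (m %/ p ^ i) =
    \sum_(1 <= i < t.+1) m.*2 %/ p ^ i.
  by rewrite -eqn -big_distrr /= mul2n addnn.
rewrite -(leq_add2r (\sum_(1 <= i < t.+1) 2 * (m %/ p ^ i))) eqn.
rewrite -[X in _ <= X + _](subn1 t.+1) -[X in _ <= X + _]muln1.
rewrite -sum_nat_const_nat -big_split /=.
apply: leq_sum => k _.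
have pk : 0 < p ^ k by rewrite expn_gt0 prime_gt0.
have h := ltn_ceil m pk.
by rewrite -ltnS ltn_divLR // -mul2n; nia.
Qed.

Lemma prime_dvd_fact p n : prime p -> p %| n`! -> p <= n.
Proof.
move=> pp; rewrite fact_prod Euclid_dvd_prod // big_has => /hasP[i].
rewrite mem_index_iota => /andP[i0 iN] /(dvdn_leq i0) pi.
by apply: leq_trans pi _; rewrite -ltnS.
Qed.

Definition prime_count (x : nat) : nat := count prime (index_iota 1 x.+1).

(** With [m = 2 ^ j], the central binomial coefficient is at least [2 ^ m], and at most [m.*2] to
    the number of primes up to [m.*2]; the exponents of 2 are compared. *)
Lemma chebyshev j : 2 ^ j <= j.+1 * prime_count (2 ^ j.+1).
Proof.
set m := 2 ^ j; have m0 : 0 < m by rewrite expn_gt0.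
have dm : m.*2 = 2 ^ j.+1 by rewrite expnS mul2n.
rewrite -(@leq_exp2l 2) // expnM -dm.
apply: leq_trans (central_bin_ge m) _.
have bin0 : 0 < 'C(m.*2, m) by rewrite bin_gt0 -addnn leq_addr.
rewrite {1}(prod_prime_decomp bin0) prime_decompE big_map /= /prime_count.
apply: (@leq_trans (m.*2 ^ size (primes 'C(m.*2, m)))).
  rewrite -(count_predT (primes _)) -iter_muln_1 -big_const_seq.
  rewrite big_seq [X in _ <= X]big_seq; apply: leq_prod => p.
  rewrite mem_primes => /andP[pp _]; exact: pfactor_central_bin_le.
rewrite leq_pexp2l ?double_gt0 // -size_filter.
apply: uniq_leq_size; first exact: primes_uniq.
move=> p; rewrite mem_primes mem_filter mem_index_iota => /and3P[pp _ pC].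
rewrite pp prime_gt0 // ltnS /= leqNgt; apply/negP => mp.
have : p %| m.*2`!.
  rewrite -(bin_fact (leq_trans (leq_addr m m) (eq_leq (addnn m)))).
  exact: dvdn_mulr.
by move/(prime_dvd_fact pp); rewrite leqNgt mp.
Qed.

End Chebyshev.

(** * Sifting r and a r + 1 simultaneously *)

Section PairDivisible.
Local Open Scope nat_scope.

Definition pair_divisible (a l r : nat) : bool := l %| r * (a * r + 1).

Lemma pair_divisible_mod a l r : pair_divisible a l (r %% l) = pair_divisible a l r.
Proof.
rewrite /pair_divisible /dvdn.
have e : a * (r %% l) + 1 = a * r + 1 %[mod l] by rewrite -modnDml modnMmr modnDml.
by rewrite -modnMm modn_mod e modnMm.
Qed.

(** The two classes are 0 and the inverse of [- a], called [r0]; they differ because [r0] is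
    invertible. *)
Lemma count_pair_divisible a l : prime l -> ~~ (l %| a) ->
  \sum_(0 <= r < l) pair_divisible a l r = 2.
Proof.
move=> pl la; have l0 := prime_gt0 pl.
have cla : coprime l a by rewrite prime_coprime.
have [r0 r0l] := Bezoutl a l0; rewrite (eqP cla) => lr0.
have r0N0 : r0 != 0.
  by apply: contraTneq lr0 => ->; rewrite mul0n addn0 dvdn1; case: eqP pl => // ->.
rewrite (eq_big_nat _ _ (F2 := fun r => (r == 0) + (r == r0))).
  rewrite big_split /= -!big_mkcond /=.
  by rewrite !sum1_count !count_uniq_mem ?iota_uniq // !mem_index_iota r0l l0.
move=> r /andP[_ rl]; rewrite /pair_divisible Euclid_dvdM //.
have -> : (l %| r) = (r == 0).
  by case: r rl => [|r] rl; rewrite ?dvdn0 // gtnNdvd.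
have -> : (l %| a * r + 1) = (r == r0).
  apply/idP/eqP => [lr|->]; last by rewrite addnC mulnC.
  have : a * r + 1 == a * r0 + 1 %[mod l].
    rewrite (eqP (lr : _ %% _ == 0)) eq_sym.
    by move: lr0; rewrite addnC mulnC.
  rewrite eqn_modDr.
  wlog le_r : r r0 r0l rl {r0N0 lr lr0} / r <= r0.
    move=> H; case/orP: (leq_total r r0) => [/H|/H]; first exact.
    by move=> H' e; apply/esym/H' => //; rewrite eq_sym.
  rewrite eq_sym eqn_mod_dvd ?leq_mul2l ?le_r ?orbT // -mulnBr Gauss_dvdr //.
  have [->//|rr0] := eqVneq r r0.
  rewrite gtnNdvd ?subn_gt0 //; first by rewrite ltn_neqAle rr0.
  by apply: leq_ltn_trans r0l; exact: leq_subr.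
by case: (r =P 0) => [->|]; rewrite 1?eq_sym ?(negbTE r0N0) //= addn0.
Qed.

Definition rough_pair (a z r : nat) : bool :=
  all (fun l => prime l ==> ~~ pair_divisible a l r) (iota 0 z.+1).

End PairDivisible.

(** The sieve gives [N * G ^ 2 <= Y * G + z ^ 4], so [N <= Y / G + z ^ 4] because the term at 1
    makes [G >= 1]; then [sieve_total_ge] bounds [G] from below. *)
Lemma count_rough_pair (R : realFieldType) (a Y Z : nat) : (0 < a)%N -> (0 < Z)%N ->
  (\sum_(0 <= r < Y) rough_pair a (Z * Z) r)%:R <=
  Y%:R * (mertens R (6 * a) / harm R Z) ^+ 2 + ((Z * Z) ^ 4)%:R.
Proof.
move=> a0 Z0; set z := (Z * Z)%N; set b := (6 * a)%N.
have b0 : (0 < b)%N by rewrite muln_gt0.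
have b6 : (6 %| b)%N by rewrite dvdn_mulr.
have mem_l n l : sieving_modulus b n -> l \in primes n ->
    [/\ prime l, (4 <= l)%N, ~~ (l %| a)%N & (l %| n)%N /\ (0 < n)%N].
  case/andP=> _ nb; rewrite mem_primes => /and3P[pl n0 ln].
  have lb : coprime l b by exact: coprime_dvdl ln nb.
  split=> //; last first.
    by rewrite -prime_coprime //; apply: coprime_dvdr lb; exact: dvdn_mull.
  case: l pl lb {ln} => [|[|[|[|l]]]] //= _; rewrite ?prime_coprime //.
    by rewrite (dvdn_trans _ b6).
  by rewrite (dvdn_trans _ b6).
have := @sieve_bound R (pair_divisible a) (sieving_modulus b) z
  (fun l r _ => pair_divisible_mod a l r) _ _ _ Y (rough_pair a z).
set N := (\sum_(0 <= r < Y) _)%:R; set G := sieve_total _ _ _ => sieveE.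
have {sieveE} NG : N * G ^+ 2 <= Y%:R * G + (z ^ 4)%:R.
  apply: sieveE.
  - by move=> n /andP[].
  - by move=> n l nI /(mem_l _ _ nI)[].
  - by move=> n l nI /(mem_l _ _ nI)[pl _ la _]; exact: count_pair_divisible.
  move=> r /allP rr n l nI nz /(mem_l _ _ nI)[pl _ _ [ln n0]].
  have := rr l; rewrite mem_iota ltnS (leq_trans (dvdn_leq n0 ln) nz) pl.
  exact.
have GH : (harm R Z / mertens R b) ^+ 2 <= G by exact: sieve_total_ge.
have m1 := mertens_ge1 R b.
have H1 : 1 <= harm R Z.
  rewrite /harm big_ltn ?ltnS // invr1 lerDl.
  by apply: sumr_ge0 => k _; rewrite invr_ge0.
have hpos : 0 < harm R Z / mertens R b by rewrite divr_gt0 //; lra.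
have Gpos : 0 < G by apply: lt_le_trans GH; rewrite exprn_gt0.
have G1 : 1 <= G.
  rewrite /G /sieve_total big_mkcond big_ltn ?ltnS ?muln_gt0 ?Z0 //=.
  rewrite /sieving_modulus coprime1n /squarefree /= !big_nil eqxx /= lerDl.
  apply: sumr_ge0 => n _; case: ifP => // nI.
  rewrite big_seq prodr_ge0 // => l /(mem_l _ _ nI)[_ l4 _ _].
  by rewrite divr_ge0 // subr_ge0 (ler_nat _ 2); apply: leq_trans l4.
have NY : N <= Y%:R / G + (z ^ 4)%:R.
  have z0 : 0 <= (z ^ 4)%:R :> R by [].
  have -> : Y%:R / G + (z ^ 4)%:R = (Y%:R * G + (z ^ 4)%:R * G ^+ 2) / G ^+ 2.
    by field; rewrite gt_eqF.
  rewrite ler_pdivlMr ?exprn_gt0 //; apply: le_trans NG _.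
  by rewrite lerD2l ler_peMr // exprn_ege1.
apply: le_trans NY _; rewrite lerD2r ler_wpM2l //.
have -> : (mertens R b / harm R Z) ^+ 2 = ((harm R Z / mertens R b) ^+ 2)^-1.
  by rewrite -exprVn invf_div.
by rewrite lef_pV2 ?posrE // exprn_gt0.
Qed.

(** * Counting primes p with p - 1 smooth *)

Definition smooth (y n : nat) : bool := all (fun q => q <= y)%N (primes n).

(** Such a prime is [p = a * q + 1] with [q > y] prime, so [a <= s] and [q <= x %/ a]. Both [q] and
    [p] are primes above [z], so [q] survives the sieve attached to [a]. *)
Lemma nonsmooth_shifted_primes_le (z s y x : nat) : (z < y)%N -> (0 < y)%N ->
    (x <= s * y)%N ->
  (count (fun p => prime p && ~~ smooth y p.-1) (index_iota 1 x.+1) <=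
   \sum_(1 <= a < s.+1) \sum_(0 <= r < (x %/ a).+1) rough_pair a z r)%N.
Proof.
move=> zy y0 xy.
pose L := [seq (a * q + 1)%N | a <- index_iota 1 s.+1,
   q <- seq.filter (rough_pair a z) (index_iota 0 (x %/ a).+1)].
have -> : (\sum_(1 <= a < s.+1) \sum_(0 <= r < (x %/ a).+1) rough_pair a z r =
    size L)%N.
  rewrite /L size_allpairs_dep sumnE big_map.
  apply: eq_bigr => a _; rewrite size_filter -sum1_count.
  by rewrite [RHS]big_mkcond; apply: eq_bigr => r _; case: rough_pair.
rewrite -size_filter; apply: uniq_leq_size; first by rewrite filter_uniq ?iota_uniq.
move=> p; rewrite mem_filter mem_index_iota => /andP[/andP[pp /allPn[q]]].
rewrite mem_primes -ltnNge => /and3P[pq p0 /dvdnP[a defa]] yq /andP[_ px].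
have q0 := prime_gt0 pq.
have a0 : (0 < a)%N by move: p0; rewrite defa muln_gt0 => /andP[].
have defp : p = (a * q + 1)%N by rewrite -defa addn1 prednK ?prime_gt0.
apply/allpairsPdep; exists a; exists q; split=> //.
  rewrite mem_index_iota a0 ltnS.
  rewrite -(leq_pmul2r y0); apply: leq_trans xy.
  by rewrite defp in px; nia.
rewrite mem_filter mem_index_iota /= ltnS leq_divRL // mulnC.
rewrite (_ : (a * q <= x)%N); last by rewrite defp in px; lia.
rewrite andbT; apply/allP => l; rewrite mem_iota ltnS => /= lz.
apply/implyP => pl; rewrite /pair_divisible Euclid_dvdM // -defp.
rewrite !dvdn_prime2 // negb_or !neq_ltn.
rewrite defp in px *.
have -> : (l < q)%N by lia.
by have -> : (l < a * q + 1)%N by nia.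
Qed.

(** The smoothness bound is [x / 2 ^ s], and the sifting goes up to [Z ^ 2] with [Z = 2 ^ (s * n)].
    The remainders [Z ^ 8 = 2 ^ (8 * s * n)], one for each of [2 ^ s] values of [a], add up to
    [x / 2 ^ (2 * s)]. In the main term [x / a + 1 <= 2 * x / a], [harm Z >= s * n / 2] and
    [harm (2 ^ s) <= 2 * s], whence the constant [2 * 4 * 512 * 2 = 8192]. *)
Lemma nonsmooth_shifted_primes_bound (R : realFieldType) (s n x : nat) :
    (0 < s)%N -> (0 < n)%N -> x = (2 ^ (s * (8 * n + 3)))%N ->
  (count (fun p => prime p && ~~ smooth (2 ^ (s * (8 * n + 2))) p.-1)
     (index_iota 1 x.+1))%:R <=
  8192 * mertens R 6 ^+ 2 / (s%:R * n%:R ^+ 2) * x%:R + x%:R / (2 ^ (2 * s))%:R.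
Proof.
move=> s0 n0 defx.
have [xle lex] : (x <= 2 ^ (s * (8 * n + 3)))%N /\ (2 ^ (s * (8 * n + 3)) <= x)%N.
  by rewrite defx.
clear defx; set Z := (2 ^ (s * n))%N.
have Z0 : (0 < Z)%N by rewrite expn_gt0.
have z4 : ((Z * Z) ^ 4 <= 2 ^ (s * (8 * n)))%N.
  apply: eq_leq; rewrite /Z -expnD -expnM; congr (2 ^ _)%N; lia.
have x0 : (0 < x)%N by apply: leq_trans lex; rewrite expn_gt0.
have Zy : (Z * Z < 2 ^ (s * (8 * n + 2)))%N.
  by rewrite -expnD ltn_exp2l //; nia.
have xsy : (x <= 2 ^ s * 2 ^ (s * (8 * n + 2)))%N.
  by apply: leq_trans xle _; rewrite -expnD leq_exp2l //; nia.
have := nonsmooth_shifted_primes_le Zy _ xsy.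
rewrite expn_gt0 /= => /(_ isT); rewrite -(ler_nat R) => le1.
apply: le_trans le1 _.
have sR : 1 <= s%:R :> R by rewrite (ler_nat _ 1).
have nR : 1 <= n%:R :> R by rewrite (ler_nat _ 1).
have /andP[Hlow _] := harm_pow2 R (s * n); rewrite -/Z natrM in Hlow.
have /andP[_ Hup] := harm_pow2 R s.
set H := harm R Z in Hlow.
have snpos : 0 < s%:R * n%:R :> R by rewrite mulr_gt0; lra.
have Hpos : 0 < H by apply: lt_le_trans Hlow; rewrite divr_gt0.
set m6 := mertens R 6; have m61 : 1 <= m6 := mertens_ge1 R 6.
pose c : R := 2 * x%:R * (m6 / H) ^+ 2.
have c0 : 0 <= c by rewrite /c mulr_ge0 ?sqr_ge0 // mulr_ge0.
apply: (@le_trans _ _ (\sum_(1 <= a < (2 ^ s).+1)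
    (c * (mertens R a ^+ 2 / a%:R) + ((Z * Z) ^ 4)%:R))).
  rewrite natr_sum; apply: ler_sum_nat => a /andP[a0 aw].
  apply: le_trans (count_rough_pair R _ a0 Z0) _; rewrite lerD2r.
  have aR : 0 < a%:R :> R by rewrite ltr0n.
  have xa : (x %/ a).+1%:R <= 2 * x%:R / a%:R :> R.
    rewrite ler_pdivlMr // -!natrM ler_nat.
    have := leq_trunc_div x a; rewrite mulSn.
    have : (a <= x)%N.
      rewrite ltnS in aw; apply: (leq_trans aw (leq_trans _ lex)).
      by rewrite leq_exp2l //; nia.
    lia.
  have m1 := mertens_ge1 R a.
  have m6a : mertens R (6 * a) <= m6 * mertens R a by exact: mertens_mul.
  have m6a1 := mertens_ge1 R (6 * a).
  apply: (@le_trans _ _ (2 * x%:R / a%:R * (m6 * mertens R a / H) ^+ 2)); last first.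
    suff -> : 2 * x%:R / a%:R * (m6 * mertens R a / H) ^+ 2 =
      c * (mertens R a ^+ 2 / a%:R) by [].
    by rewrite /c; field; rewrite !gt_eqF.
  rewrite ler_pM ?sqr_ge0 // lerXn2r ?nnegrE ?divr_ge0 ?mulr_ge0 //; try lra.
    exact: ltW.
  by rewrite ler_pM2r ?invr_gt0.
rewrite big_split /= -big_distrr /= sumr_const_nat subn1 /=.
apply: lerD; last first.
  rewrite -mulrnA ler_pdivlMr ?ltr0n ?expn_gt0 // -natrM ler_nat.
  apply: leq_trans lex; apply: (@leq_trans (2 ^ (s * (8 * n)) * 2 ^ s * 2 ^ (2 * s))).
    by rewrite !leq_mul2r z4 !orbT.
  by rewrite -!expnD leq_exp2l //; nia.
apply: (@le_trans _ _ (c * (512 * (2 * s%:R)))).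
  rewrite ler_wpM2l //; apply: le_trans (sum_mertens_sqr_le _ _) _.
  by rewrite (ler_wpM2l (ler0n _ _)) //; lra.
have -> : 8192 * m6 ^+ 2 / (s%:R * n%:R ^+ 2) * x%:R =
   2 * x%:R * (m6 / (s%:R * n%:R / 2)) ^+ 2 * (512 * (2 * s%:R)).
  by field; rewrite !gt_eqF //; lra.
rewrite ler_wpM2r ?(mulr_ge0 (ler0n _ _)) // /c ler_wpM2l ?mulr_ge0 ?ler0n //.
have m60 : 0 < m6 by apply: lt_le_trans m61.
have [H0 sn0] := (ltW Hpos, ltW snpos).
rewrite lerXn2r ?nnegrE ?divr_ge0 ?(ltW m60) //.
by rewrite ler_pM2l // lef_pV2 ?posrE ?divr_gt0.
Qed.

(** With [N = 8 * n + 3 <= 11 * n], both parts of the bound for [bad] are at most [x / (8 * s * N)];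
    here [88 = 8 * 11]. So [bad] is at most half of the lower bound [x / (2 * s * N)] for
    [primes]. *)
Lemma real_count_bound (R : realFieldType) (s n x bad good primes w K : R) :
    0 <= 88 * K -> 88 * K <= n -> 1 <= s -> 1 <= n -> 0 < x ->
    bad <= K / (s * n ^+ 2) * x + w -> primes <= good + bad ->
    w <= x / (8 * s * (8 * n + 3)) -> x <= 2 * (s * (8 * n + 3)) * primes ->
  x <= 4 * (s * (8 * n + 3)) * good.
Proof.
move=> K0 nK s1 n1 x0 badle tot b2 ch.
have s0 : 0 < s by lra.
have n0 : 0 < n by lra.
set N := 8 * n + 3 in b2 ch *.
have N1 : N <= 11 * n by rewrite /N; lra.
have N0 : 0 < N by rewrite /N; lra.
clearbody N.
have b1 : K / (s * n ^+ 2) * x <= x / (8 * s * N).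
  rewrite mulrC ler_wpM2l ?(ltW x0) //.
  rewrite ler_pdivrMr ?mulr_gt0 ?exprn_gt0 // mulrC ler_pdivlMr ?mulr_gt0 //.
  have K1 : 0 <= 8 * K by lra.
  have h : 8 * K * N <= n ^+ 2.
    apply: (@le_trans _ _ (8 * K * (11 * n))); first by rewrite ler_wpM2l.
    have -> : 8 * K * (11 * n) = 88 * K * n by ring.
    by rewrite expr2 ler_wpM2r // ltW.
  have -> : K * (8 * s * N) = s * (8 * K * N) by ring.
  by rewrite ler_wpM2l // ltW.
have : bad <= x / (4 * s * N).
  have -> : x / (4 * s * N) = x / (8 * s * N) + x / (8 * s * N).
    by field; rewrite !gt_eqF.
  by apply: le_trans badle _; apply: lerD.
rewrite ler_pdivlMr ?mulr_gt0 // => badN.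
have sN : 0 < s * N by rewrite mulr_gt0.
have : s * N * primes <= s * N * (good + bad) by rewrite ler_wpM2l // ltW.
have e1 : 2 * (s * N) * primes = 2 * (s * N * primes) by ring.
have e2 : 4 * (s * N) * good = 4 * (s * N * good) by ring.
have e3 : bad * (4 * s * N) = 4 * (s * N * bad) by ring.
by move: ch badN; rewrite mulrDr e1 e2 e3; lra.
Qed.

Lemma many_smooth_shifted_primes (R : archiRealFieldType) :
  exists2 N, (1 < N)%N & forall s, (8 * N <= 2 ^ s)%N ->
  (2 ^ (s * N) <= 4 * (s * N) *
    count (fun p => prime p && smooth (2 ^ (s * N.-1)) p.-1)
      (index_iota 1 (2 ^ (s * N)).+1))%N.
Proof.
pose K : R := 8192 * mertens R 6 ^+ 2.
have K0 : 0 <= 88 * K.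
  by rewrite (mulr_ge0 (ler0n _ _)) // (mulr_ge0 (ler0n _ _) (sqr_ge0 _)).
(* [n] depends on the sieve constant [K] alone, so [N = 8 * n + 3] is absolute. *)
pose n := (Num.bound (88 * K)).+1.
have nK : 88 * K <= n%:R.
  apply: ltW (lt_le_trans (archi_boundP K0) _).
  by rewrite ler_nat.
have n0 : (0 < n)%N by [].
move: n nK n0 => n nK n0.
exists (8 * n + 3)%N; first by lia.
move=> s Ns.
have s0 : (0 < s)%N by case: s Ns => //; rewrite expn0; lia.
have := nonsmooth_shifted_primes_bound R s0 n0 (erefl _); rewrite -/K.
have -> : ((8 * n + 3).-1 = 8 * n + 2)%N by rewrite addn3 addn2.
set y := (2 ^ (s * (8 * n + 2)))%N; set x := (2 ^ (s * (8 * n + 3)))%N.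
set bad := count _ _; set good := count _ _ => badle.
have tot : (prime_count x <= good + bad)%N.
  apply: eq_leq; rewrite /prime_count /bad /good -!sum1_count.
  exact: (bigID (fun p => smooth y p.-1)).
have ch : (x <= 2 * (s * (8 * n + 3)) * prime_count x)%N.
  have := chebyshev (s * (8 * n + 3)).-1.
  rewrite prednK ?muln_gt0 ?s0 ?addn_gt0 ?orbT // -/x -(leq_pmul2l (ltn0Sn 1)) -expnS.
  by rewrite prednK ?muln_gt0 ?s0 ?addn_gt0 ?orbT // mulnA.
have sR : 1 <= s%:R :> R by rewrite (ler_nat _ 1).
have nR : 1 <= n%:R :> R by rewrite (ler_nat _ 1).
have xR : 0 < x%:R :> R by rewrite ltr0n expn_gt0.
move: tot ch; rewrite -!(ler_nat R) natrD natrM => tot ch.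
have b2 : x%:R / (2 ^ (2 * s))%:R <= x%:R / (8 * s%:R * (8 * n + 3)%:R) :> R.
  rewrite ler_wpM2l ?(ltW xR) // -!natrM.
  rewrite lef_pV2 ?posrE ?ltr0n ?expn_gt0 ?muln_gt0 ?s0 ?addn_gt0 ?orbT //.
  rewrite ler_nat mulnAC mul2n -addnn expnD leq_mul //.
  by rewrite ltnW // ltn_expl.
move: b2 ch; rewrite !natrM natrD natrM.
move: (s%:R) (n%:R) (x%:R) (bad%:R) (good%:R) ((prime_count x)%:R) ((2 ^ (2 * s))%:R)
  K K0 nK sR nR xR badle tot.
clear=> S n' X B G P W K K0 nK sR nR xR badle tot b2 ch.
exact: real_count_bound badle tot b2 ch.
Qed.

(** * A modulus with few residues of power products *)

Section Modulus.
Local Open Scope nat_scope.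

Lemma prod_primes_dvd (s : seq nat) n : uniq s -> all prime s ->
  {in s, forall p, p %| n} -> \prod_(p <- s) p %| n.
Proof.
elim: s => [|p s IHs] /=; first by rewrite big_nil dvd1n.
move=> /andP[ps us] /andP[pp pr] sn; rewrite big_cons Gauss_dvd.
  rewrite sn ?inE ?eqxx // IHs // => q qs.
  by rewrite sn // inE qs orbT.
rewrite prime_coprime // Euclid_dvd_prod // big_has; apply/hasPn => q qs.
rewrite dvdn_prime2 ?(allP pr _ qs) //.
by apply: contraNneq ps => ->.
Qed.

(** Fermat's theorem, with exponent [L.+1] so that multiples of [p] are covered as well. *)
Lemma fermat_exp p L a : prime p -> p.-1 %| L -> a ^ L.+1 = a %[mod p].
Proof.
move=> pp /dvdnP[j ->].
have [pa|pa] := boolP (p %| a).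
  rewrite (eqP (pa : a %% p == 0)); apply/eqP.
  by rewrite -/(dvdn _ _) expnS dvdn_mulr.
have ca : coprime a p by rewrite coprime_sym prime_coprime.
have e : a ^ (j * p.-1) = 1 %[mod p].
  rewrite mulnC expnM -modnXm -(totient_prime pp) cyclic.Euler_exp_totient //.
  by rewrite modnXm exp1n.
by rewrite expnS -modnMmr e modnMmr muln1.
Qed.

(** Each prime [q] of [n] divides [y!], and its exponent [e] is below [b] because
    [2 ^ e <= q ^ e <= n < 2 ^ b]. *)
Lemma smooth_dvd_fact_exp y b n : 0 < n -> smooth y n -> n < 2 ^ b -> n %| y`! ^ b.
Proof.
move=> n0 sm nb; apply/dvdn_partP => // q; rewrite mem_primes => /and3P[pq _ qn].
have qy : q <= y by apply: (allP sm); rewrite mem_primes pq n0.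
rewrite p_part; apply: (@dvdn_trans (y`! ^ logn q n)).
  by rewrite dvdn_exp2r // dvdn_fact // prime_gt0.
apply: dvdn_exp2l; rewrite -(@leq_exp2l 2) //.
apply: leq_trans (ltnW nb); apply: leq_trans (dvdn_leq n0 (pfactor_dvdnn q n)).
by case: (logn q n) => // e; rewrite leq_exp2r // prime_gt1.
Qed.

Lemma fact_le_exp n : n`! <= n ^ n.
Proof.
rewrite -ffactnn ffact_prod -[X in _ <= _ ^ X]card_ord -prod_nat_const.
by apply: leq_prod => i _; exact: leq_subr.
Qed.

(* The modulus is the product of the primes counted in the last hypothesis, and
   [L] is [y`! ^ (s * N)] with [y = 2 ^ (s * N.-1)]. *)
Lemma modulus_of_smooth_primes N s M : 1 < N -> 0 < M ->
    16 * M * (s * N) ^ 3 < 2 ^ s ->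
    2 ^ (s * N) <= 4 * (s * N) *
      count (fun p => prime p && smooth (2 ^ (s * N.-1)) p.-1)
        (index_iota 1 (2 ^ (s * N)).+1) ->
  exists m L, [/\ 0 < m, 0 < L, forall a, a ^ L.+1 = a %[mod m],
     forall k t, k * t = M -> (1 + 2 * L.+1 ^ t) ^ k < m &
     m <= 2 ^ (s * N * 2 ^ (s * N))].
Proof.
move=> N1 M0 Ms Gs.
have s0 : 0 < s by case: s Gs {Ms} => //; rewrite !mul0n muln0.
move: Gs; rewrite -size_filter.
set y := 2 ^ (s * N.-1); set x := 2 ^ (s * N).
set G := seq.filter _ _ => Gx.
have y0 : 0 < y by rewrite expn_gt0.
have inG p : p \in G -> [/\ prime p, smooth y p.-1 & p <= x].
  by rewrite mem_filter mem_index_iota ltnS => /andP[/andP[-> ->] /andP[_ ->]].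
have uG : uniq G by rewrite filter_uniq ?iota_uniq.
have pG : all prime G by apply/allP => p /inG[].
have N0 : 0 < N by apply: ltnW.
pose m := \prod_(p <- G) p; pose L := y`! ^ (s * N).
have m0 : 0 < m by rewrite /m big_seq prodn_cond_gt0 // => p /inG[/prime_gt0].
have xE : x = 2 ^ s * y by rewrite /x /y -expnD; congr (2 ^ _); nia.
have le_m : 2 ^ size G <= m.
  rewrite -(count_predT G) -iter_muln_1 -big_const_seq /m.
  by rewrite big_seq [X in _ <= X]big_seq; apply: leq_prod => p /inG[/prime_gt1].
have L0 : 0 < L by rewrite expn_gt0 fact_gt0.
have leL : L <= 2 ^ (s * N * (s * N) * y).
  apply: (@leq_trans ((y ^ y) ^ (s * N))).
    by rewrite leq_exp2r ?fact_le_exp // muln_gt0 s0.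
  rewrite -!expnM leq_exp2l //; nia.
exists m, L; split=> //.
- move=> a; have le_a : a <= a ^ L.+1.
    by case: a => // a; rewrite expnS leq_pmulr ?expn_gt0.
  apply/eqP; rewrite eqn_mod_dvd //; apply: prod_primes_dvd => // p /inG[pp sp px].
  rewrite -eqn_mod_dvd //; apply/eqP; apply: fermat_exp => //.
  apply: smooth_dvd_fact_exp => //.
    by rewrite -ltnS prednK ?prime_gt0 // prime_gt1.
  by apply: leq_trans px; rewrite prednK ?prime_gt0.
(* With [u = s * N], the left side is at most [(8 * L) ^ M], hence at most 2 to the power
   [(3 + u ^ 2 * y) * M]. This exponent is below [size G], since [4 * u * size G >= x = 2 ^ s * y >
   16 * M * u ^ 3 * y]. *)
- move=> k t ktM; apply: leq_trans le_m.
  have [k0 t0] : 0 < k /\ 0 < t by move: M0; rewrite -ktM muln_gt0 => /andP[].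
  apply: (@leq_ltn_trans ((8 * L) ^ M)).
    rewrite (_ : M = t * k); last by rewrite -ktM mulnC.
    rewrite expnM leq_exp2r //.
    apply: (@leq_trans (4 ^ t * (2 * L) ^ t)); last by rewrite -expnMn mulnA.
    have L1 : L.+1 ^ t <= (2 * L) ^ t by rewrite leq_exp2r //; lia.
    have L2 : 0 < (2 * L) ^ t by rewrite expn_gt0 muln_gt0 L0.
    have L3 : 4 <= 4 ^ t by rewrite -[X in X <= _]expn1 leq_exp2l.
    nia.
  apply: (@leq_ltn_trans (2 ^ ((3 + s * N * (s * N) * y) * M))).
    by rewrite expnM leq_exp2r // expnD leq_mul.
  rewrite ltn_exp2l //.
  move: Gx; rewrite xE.
  have sN0 : 0 < s * N by rewrite muln_gt0 s0.
  move: (s * N) sN0 (2 ^ s) Ms (size G) => u u0 w Ms c Gx.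
  rewrite -(@ltn_pmul2l (4 * u)) ?muln_gt0 //; apply: leq_trans Gx.
  apply: (@leq_trans (16 * M * u ^ 3 * y).+1); last by rewrite ltn_pmul2r.
  rewrite ltnS; have uy : 3 + u * u * y <= 4 * (u * u * y).
    have : 0 < u * u * y by rewrite !muln_gt0 u0.
    by move: (u * u * y) => v; lia.
  apply: (@leq_trans (4 * u * (4 * (u * u * y) * M))).
    by rewrite leq_mul2l leq_mul2r uy !orbT.
  by apply: eq_leq; rewrite !expnS expn0 muln1; lia.
apply: (@leq_trans (x ^ size G)).
  rewrite -(count_predT G) -iter_muln_1 -big_const_seq /m.
  by rewrite big_seq [X in _ <= X]big_seq; apply: leq_prod => p /inG[].
rewrite /x [X in _ <= X]expnM leq_pexp2l ?expn_gt0 //.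
rewrite size_filter; apply: leq_trans (count_size _ _) _.
by rewrite size_iota subn1.
Qed.

(** Taking [s] proportional to the binary logarithm of [M] makes [2 ^ s] large enough for the
    preceding lemma, yet bounded by a fixed power of [M]. *)
Lemma modulus_exists : exists D, forall M, 1 < M ->
  exists m L, [/\ 0 < m, 0 < L, forall a, a ^ L.+1 = a %[mod m],
     forall k t, k * t = M -> (1 + 2 * L.+1 ^ t) ^ k < m &
     m <= 2 ^ (M ^ D)].
Proof.
have [N N1 HN] := many_smooth_shifted_primes rat.
have [B B0 BN] : exists2 B, 0 < B & 16 * (B * N) ^ 3 < 2 ^ (B - 4).
  (* Chosen so that [b ^ 4 = 2 ^ 4 * (16 * (4 * b * N) ^ 3)]; then [b < 2 ^ b] gives the claim for
     [B = 4 * b]. *)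
  pose b := 2 ^ 10 * (16 * N ^ 3).
  have b0 : 0 < b by rewrite /b muln_gt0 expn_gt0 muln_gt0 expn_gt0 (ltnW N1).
  exists (4 * b); first by rewrite muln_gt0.
  have -> : 4 * b - 4 = 4 * b.-1 by lia.
  have b2 : b < 2 ^ b by rewrite ltn_expl.
  have : b ^ 3 * b < (2 ^ b) ^ 3 * 2 ^ b.
    by apply: ltn_mul => //; rewrite ltn_exp2r.
  rewrite -!expnSr -expnM (mulnC b) => b4.
  rewrite -(@ltn_pmul2r (2 ^ 4)) //.
  rewrite -expnD -mulnSr prednK //; apply: leq_ltn_trans b4.
  apply: eq_leq; have -> : b ^ 4 = b ^ 3 * (2 ^ 10 * (16 * N ^ 3)) by rewrite expnSr.
  move: b {b0 b2} => b.
  by rewrite !expnS expn0; lia.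
(* From [2 ^ r <= 2 * M <= M ^ 2] follows [2 ^ (2 * s * N) <= M ^ (4 * B * N)]. *)
exists (4 * (B * N)) => M M1.
pose r := (trunc_log 2 M).+1; pose s := B * r.
have M0 : 0 < M by apply: ltnW.
have Mr : M < 2 ^ r by exact: trunc_log_ltn.
have rM : 2 ^ r <= 2 * M by rewrite expnS leq_mul2l trunc_logP.
have Ms : 16 * M * (s * N) ^ 3 < 2 ^ s.
  have rr : r < 2 ^ r by rewrite ltn_expl.
  have B4 : 4 <= B.
    case: (leqP 4 B) => // /ltnW; rewrite -subn_eq0 => /eqP e.
    by move: BN; rewrite e; nia.
  apply: (@leq_ltn_trans (16 * (B * N) ^ 3 * 2 ^ (4 * r))).
    have -> : s * N = B * N * r by rewrite /s; lia.
    have key : M * r ^ 3 <= 2 ^ (4 * r).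
      rewrite (_ : 4 * r = r + r * 3); last by lia.
      by rewrite expnD expnM leq_mul // ltnW // ltn_exp2r.
    rewrite (expnMn (B * N)); move: ((B * N) ^ 3) (r ^ 3) key => c w key.
    rewrite (_ : 16 * M * (c * w) = 16 * c * (M * w)); last by lia.
    by rewrite leq_mul2l key orbT.
  apply: (@leq_trans (2 ^ (B - 4) * 2 ^ (4 * r))).
    by rewrite ltn_pmul2r ?expn_gt0.
  rewrite -expnD leq_exp2l // /s.
  have r0 : 0 < r by [].
  by nia.
have Ns : 8 * N <= 2 ^ s.
  apply: leq_trans (ltnW Ms).
  have sN : N <= s * N by rewrite leq_pmull // muln_gt0 B0.
  have N3 : N <= (s * N) ^ 3.
    apply: leq_trans sN _; rewrite -[X in X <= _]expn1 leq_pexp2l //.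
    by rewrite muln_gt0 muln_gt0 B0 /= ltnW.
  nia.
have [m [L [m0 L0 mL mk mx]]] := modulus_of_smooth_primes N1 M0 Ms (HN s Ns).
exists m, L; split=> //; apply: leq_trans mx _; rewrite leq_exp2l //.
apply: (@leq_trans (2 ^ (s * N) * 2 ^ (s * N))).
  by rewrite leq_mul2r ltnW ?orbT // ltn_expl.
rewrite -expnD addnn -mul2n /s.
have -> : 2 * (B * r * N) = r * (2 * (B * N)) by nia.
have -> : 4 * (B * N) = 2 * (2 * (B * N)) by nia.
rewrite !(expnM _ _ (2 * (B * N))).
case: (posnP (2 * (B * N))) => [->|e0]; first by rewrite !expn0.
rewrite leq_exp2r //; apply: leq_trans rM _; rewrite -mulnn leq_mul2r M1 orbT //.
Qed.

End Modulus.

(** * Double-base expansions *)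

Section DoubleBaseExpansions.
Local Open Scope nat_scope.

(** * Powers modulo a prime power *)

Lemma binomial_second_order y n : exists r, (1 + y) ^ n = 1 + n * y + y ^ 2 * r.
Proof.
elim: n => [|n [r IHn]]; first by exists 0; rewrite !mul0n muln0.
exists (n + r + y * r); rewrite expnS IHn; lia.
Qed.

(** A [p]-th power raises the exact order of [p] in [Q - 1] by one. As [w >= 2], the second-order
    term is divisible by [p ^ (w + 2)] at every prime, 2 included. *)
Lemma lift_exponent p w u : prime p -> 1 < w -> ~~ (p %| u) ->
  exists2 u', (1 + p ^ w * u) ^ p = 1 + p ^ w.+1 * u' & ~~ (p %| u').
Proof.
move=> pp w1 pu; have [r ->] := binomial_second_order (p ^ w * u) p.
exists (u + p ^ w.-1 * (u ^ 2 * r)).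
  rewrite expnMn -expnM -addnA; congr (_ + _).
  have -> : w * 2 = w.+1 + w.-1 by lia.
  by rewrite expnD expnS; lia.
rewrite dvdn_addl //; apply: dvdn_mulr; apply: dvdn_exp => //; lia.
Qed.

Lemma linear_congruence p c e : prime p -> ~~ (p %| c) ->
  exists2 l, l < p & l * c = e %[mod p].
Proof.
move=> pp pc; have p0 := prime_gt0 pp.
have [r _] := Bezoutl c p0.
have /eqP -> : coprime p c by rewrite prime_coprime.
(* [r] is the inverse of [- c], and [p.-1] stands for -1. *)
move=> /eqP rc; exists ((r * p.-1 * e) %% p); first exact: ltn_pmod.
apply/eqP; rewrite modnMml -(eqn_modDr (p.-1 * e)).
rewrite (_ : r * p.-1 * e * c + p.-1 * e = (1 + r * c) * (p.-1 * e)); last by lia.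
rewrite -mulSn prednK // modnMr -modnMml rc mul0n mod0n //.
Qed.

(** One base-[p] digit of [j] is found at a time. Multiplying by [Q ^ (l * p ^ i)] changes [Q ^ j]
    by [l * p ^ (v + i) * u' * Q ^ j] modulo the next power of [p], and a linear congruence
    determines [l]. *)
Lemma power_residues p v u : prime p -> 1 < v -> ~~ (p %| u) ->
  forall i x, x = 1 %[mod p ^ v] ->
  exists2 j, j < p ^ i & (1 + p ^ v * u) ^ j = x %[mod p ^ (v + i)].
Proof.
move=> pp v1 pu; have p0 := prime_gt0 pp.
set Q := 1 + _.
have lift i : exists2 u', Q ^ (p ^ i) = 1 + p ^ (v + i) * u' & ~~ (p %| u').
  elim: i => [|i [u' IHu pu']]; first by exists u; rewrite ?expn1 ?addn0.
  have [u2 e2 pu2] := lift_exponent pp (leq_trans v1 (leq_addr i v)) pu'.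
  by exists u2; rewrite // expnSr expnM IHu e2 addnS.
elim=> [|i IHi] x x1; first by exists 0; rewrite ?addn0 ?expn0.
have [j ji jx] := IHi x x1; have [u' Qu pu'] := lift i.
(* [x] is replaced by a congruent number that is at least [Q ^ j], so that the natural subtraction
   is exact. *)
pose w := v + i; pose x' := x + p ^ w.+1 * Q ^ j.
have Q0 : 0 < Q ^ j by rewrite expn_gt0.
have le_x : Q ^ j <= x'.
  rewrite /x' -[X in X <= _]mul1n (leq_trans _ (leq_addl _ _)) //.
  by rewrite leq_mul2r expn_gt0 p0 orbT.
have xx' : x' = x %[mod p ^ w.+1] by rewrite /x' addnC mulnC modnMDl.
have wv : 1 < w by apply: leq_trans v1 (leq_addr i v).
have /dvdnP[e defe] : p ^ w %| x' - Q ^ j.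
  rewrite -eqn_mod_dvd //; apply/eqP.
  rewrite /x' expnS -mulnA mulnCA addnC mulnC modnMDl.
  by rewrite jx.
have pQ : ~~ (p %| Q).
  rewrite /Q addnC dvdn_addr ?dvdn1; first by case: eqP pp => // ->.
  by apply: dvdn_mulr; apply: dvdn_exp => //; exact: ltnW.
have pc : ~~ (p %| Q ^ j * u').
  by rewrite Euclid_dvdM // negb_or pu' andbT Euclid_dvdX // negb_and pQ.
have [l lp lc] := linear_congruence e pp pc.
exists (j + l * p ^ i).
  apply: (@leq_trans (l.+1 * p ^ i)); first by rewrite mulSn ltn_add2r.
  by rewrite expnS leq_mul2r lp orbT.
rewrite addnS -/w -xx' -(subnKC le_x) defe expnD mulnC.
have [r Qr] := binomial_second_order (p ^ w * u') l.
rewrite (mulnC l) expnM Qu Qr.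
have -> : (1 + l * (p ^ w * u') + (p ^ w * u') ^ 2 * r) * Q ^ j =
    (p ^ w.-2 * u' ^ 2 * r * p * Q ^ j) * p ^ w.+1 +
    (Q ^ j + p ^ w * (l * (Q ^ j * u'))).
  have e2 : (p ^ w * u') ^ 2 = p ^ w.-2 * u' ^ 2 * p * p ^ w.+1.
    rewrite expnMn -expnM -mulnA -expnS.
    have -> : w * 2 = w.-2 + w.+2 by clear -wv; lia.
    by rewrite expnD; move: (p ^ _) (p ^ _) (u' ^ 2) => A B C; clear; lia.
  rewrite e2; move: (p ^ w) (p ^ w.+1) (p ^ w.-2) (Q ^ j) (u' ^ 2) => A B C D E.
  by clear; lia.
rewrite modnMDl -modnDmr [in RHS](mulnC e) -[in RHS]modnDmr; congr ((_ + _) %% _).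
by rewrite !expnSr -!muln_modr lc.
Qed.

(** Euler's theorem modulo [p ^ 2] makes [q ^ d - 1] divisible by [p ^ 2], so that its exact order
    [v] is at least 2, as the lifting requires. *)
Lemma power_residues_prime p q : prime p -> prime q -> p != q ->
  exists d v, [/\ 0 < d, 0 < v & forall m x, x = 1 %[mod p ^ v] ->
  exists2 j, j < p ^ m & q ^ (d * j) = x %[mod p ^ m]].
Proof.
move=> pp pq npq; pose d := totient (p ^ 2).
have p0 := prime_gt0 pp.
have d0 : 0 < d by rewrite totient_gt0 expn_gt0 p0.
have q1 : 1 < q ^ d.
  apply: leq_trans (prime_gt1 pq) _.
  by rewrite -[X in X <= _]expn1 leq_exp2l // prime_gt1.
have qd : 1 = q ^ d %[mod p ^ 2].
  rewrite cyclic.Euler_exp_totient // coprimeXr //.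
  by rewrite coprime_sym prime_coprime // dvdn_prime2.
have Q0 : 0 < q ^ d - 1 by rewrite subn_gt0.
pose v := logn p (q ^ d - 1).
have v1 : 1 < v.
  by rewrite -pfactor_dvdn // -eqn_mod_dvd // ?(ltnW q1) // eq_sym; apply/eqP.
have [u pu defQ] := pfactor_coprime pp Q0.
exists d, v; split=> //; first exact: ltnW.
move=> m x x1.
have pu' : ~~ (p %| u) by rewrite -prime_coprime.
have [j jm jx] := power_residues pp v1 pu' m x1.
exists j => //; move: jx; rewrite -/v in defQ.
rewrite mulnC in defQ; rewrite -defQ subnKC ?(ltnW q1) // -expnM => jx.
have pmv : p ^ m %| p ^ (v + m) by rewrite dvdn_exp2l // leq_addl.
by rewrite -(modn_dvdm _ pmv) jx modn_dvdm.
Qed.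

(** * Sums of products of powers of two primes *)

Definition double_base (p q k n : nat) : Prop :=
  exists2 s : seq (nat * nat), size s <= k & n = \sum_(ab <- s) p ^ ab.1 * q ^ ab.2.

Section DoubleBase.
Variables p q : nat.

Lemma double_base_add k1 k2 n1 n2 : double_base p q k1 n1 -> double_base p q k2 n2 ->
  double_base p q (k1 + k2) (n1 + n2).
Proof.
move=> [s1 s1k ->] [s2 s2k ->]; exists (s1 ++ s2); last by rewrite big_cat.
by rewrite size_cat leq_add.
Qed.

Lemma double_base_mul k n i : double_base p q k n -> double_base p q k (p ^ i * n).
Proof.
move=> [s sk ->]; exists [seq (ab.1 + i, ab.2) | ab <- s]; first by rewrite size_map.
rewrite big_map big_distrr /=; apply: eq_bigr => ab _.
by rewrite expnD mulnA; congr (_ * _); rewrite mulnC.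
Qed.

Lemma double_base_leq k1 k2 n :
  k1 <= k2 -> double_base p q k1 n -> double_base p q k2 n.
Proof. by move=> k12 [s sk ->]; exists s => //; apply: leq_trans k12. Qed.

Lemma double_base_nat k n : n <= k -> double_base p q k n.
Proof.
move=> nk; exists (nseq n (0, 0)); first by rewrite size_nseq.
by rewrite big_nseq /= muln1 iter_addn_0 mul1n.
Qed.

Lemma double_base_pow b : double_base p q 1 (q ^ b).
Proof. by exists [:: (0, b)]; rewrite // big_seq1 mul1n. Qed.

Hypotheses (pp : prime p) (pq : prime q) (npq : p != q).
Let p0 : 0 < p := prime_gt0 pp.

Lemma double_base_digits i n : n < p ^ i -> double_base p q (i * p) n.
Proof.
elim: i n => [|i IHi] n ni; first by apply: double_base_nat; rewrite -ltnS.
rewrite (divn_eq n p) addnC mulSn; apply: double_base_add.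
  by apply: double_base_nat; rewrite ltnW // ltn_pmod.
rewrite (_ : n %/ p * p = p ^ 1 * (n %/ p)); last by rewrite expn1 mulnC.
apply/double_base_mul/IHi.
by rewrite ltn_divLR // -expnSr.
Qed.

(* Each block of [m] base-[p] digits costs [p ^ v] terms as long as the remaining
   number is at least [p ^ i]; what is left is written digit by digit. *)
Lemma double_base_blocks d v m i : 0 < v ->
    (forall x, x = 1 %[mod p ^ v] ->
      exists2 j, j < p ^ m & q ^ (d * j) = x %[mod p ^ m]) ->
    p ^ v + q ^ (d * p ^ m) <= p ^ i ->
  forall J n, n < p ^ (m * J + i) -> double_base p q (p ^ v * J + i * p) n.
Proof.
move=> v0 dlog large; elim=> [|J IHJ] n nJ.
  by rewrite muln0 add0n; apply: double_base_digits; rewrite muln0 in nJ.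
have [ni|ni] := ltnP n (p ^ i).
  by apply: double_base_leq (double_base_digits ni); exact: leq_addl.
have pv0 : 0 < p ^ v by rewrite expn_gt0 p0.
(* Removing [r] ones brings [n] into the class of 1 modulo [p ^ v], which powers of [q ^ d]
   represent; [r] is taken from [n.-1]. *)
pose r := n.-1 %% p ^ v; have rv : r < p ^ v by exact: ltn_pmod.
have n0 : 0 < n by apply: leq_trans ni; rewrite expn_gt0 p0.
have rn : r < n by rewrite -(prednK n0) ltnS leq_mod.
have nr1 : n - r = 1 %[mod p ^ v].
  apply/eqP; rewrite eqn_mod_dvd ?subn_gt0 // -subnDA addnC subnDA subn1.
  by rewrite {1}(divn_eq n.-1 (p ^ v)) addnK dvdn_mull.
have [j jm jx] := dlog _ nr1.
have le_j : q ^ (d * j) <= q ^ (d * p ^ m).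
  by rewrite leq_exp2l ?prime_gt1 // leq_mul2l (ltnW jm) orbT.
have le_n : r + q ^ (d * j) <= n.
  by apply: leq_trans ni; apply: leq_trans large; apply: leq_add => //; exact: ltnW.
have /dvdnP[n' defn'] : p ^ m %| n - (r + q ^ (d * j)).
  rewrite subnDA -eqn_mod_dvd; first by rewrite -jx.
  by rewrite leq_subRL // ltnW.
have defn : n = r + q ^ (d * j) + p ^ m * n' by rewrite (mulnC (p ^ m)) -defn' subnKC.
have n'J : n' < p ^ (m * J + i).
  rewrite -(@ltn_pmul2l (p ^ m)) ?expn_gt0 ?p0 // -expnD addnA -mulnS.
  by apply: leq_ltn_trans nJ; rewrite defn leq_addl.
rewrite defn mulnS -addnA; apply: double_base_add; last exact/double_base_mul/IHJ.
apply: double_base_leq (double_base_add (double_base_nat (leqnn r)) (double_base_pow _)).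
by rewrite addn1.
Qed.

(** Half of the [k] terms pay for [J = k %/ (2 * s)] blocks, the other half for the last [D * p ^ m]
    digits, with [p ^ m] as large as this permits. The threshold [E ^ 2] ensures [k <= p ^ (2 * m)],
    and [k <= 4 * s * J], so [k ^ k <= (p ^ (m * J)) ^ (8 * s)]. *)
Lemma double_base_lower : exists S k0, 0 < S /\
  forall k n, k0 <= k -> n ^ S < k ^ k -> double_base p q k n.
Proof.
have [d [v [d0 v0 dlog]]] := power_residues_prime pp pq npq.
pose D := v + d * q; pose s := p ^ v; pose E := 2 * (D * p) * p.
have p1 := prime_gt1 pp.
have s0 : 0 < s by rewrite expn_gt0 p0.
have D0 : 0 < D by rewrite addn_gt0 v0.
have E0 : 0 < E by rewrite !muln_gt0 D0 p0.
exists (8 * s), (E ^ 2 + 2 * s); split; first by rewrite muln_gt0.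
move=> k n k_ge nk.
have kE : E ^ 2 <= k by apply: leq_trans k_ge; exact: leq_addr.
have ks : 2 * s <= k by apply: leq_trans k_ge; exact: leq_addl.
have DP0 : 0 < 2 * (D * p) by rewrite !muln_gt0 D0 p0.
pose m := trunc_log p (k %/ (2 * (D * p))).
have k2 : 0 < k %/ (2 * (D * p)).
  rewrite divn_gt0 //; apply: leq_trans kE; apply: (@leq_trans E).
    by rewrite /E leq_pmulr.
  by rewrite -[X in X <= _]expn1 leq_pexp2l.
have mk : 2 * (D * p) * p ^ m <= k.
  by rewrite mulnC -leq_divRL //; exact: trunc_logP.
have km : k < E * p ^ m.
  rewrite /E -mulnA -expnS mulnC -ltn_divLR //; exact: trunc_log_ltn.
have kpm : k <= p ^ m * p ^ m.
  rewrite leqNgt; apply/negP => h.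
  have : k * k < E * p ^ m * (E * p ^ m) by apply: ltn_mul.
  have : E * p ^ m * (E * p ^ m) <= k * k.
    have -> : E * p ^ m * (E * p ^ m) = E ^ 2 * (p ^ m * p ^ m).
      by rewrite -mulnn; move: (E) (p ^ m) => A B; clear; lia.
    by apply: leq_mul => //; exact: ltnW.
  by move=> /leq_ltn_trans H /H; rewrite ltnn.
pose J := k %/ (2 * s).
have sJ : 2 * s * J <= k by rewrite mulnC; exact: leq_trunc_div.
have kJ : k <= 4 * s * J.
  have J0 : 0 < J by rewrite divn_gt0 // muln_gt0.
  have : k < J.+1 * (2 * s) by rewrite ltn_ceil // muln_gt0.
  move: J0 => /(leq_mul (leqnn (2 * s))); rewrite muln1.
  by move: (s) (J) (k) => A B C; clear; lia.
(* Here [q < p ^ q] turns the power of [q] into one of [p], which explains [D = v + d * q]. *)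
have large : p ^ v + q ^ (d * p ^ m) <= p ^ (D * p ^ m).
  have pm0 : 0 < p ^ m by rewrite expn_gt0 p0.
  have a2 : 2 <= p ^ v.
    by apply: (leq_trans (prime_gt1 pp)); rewrite -[X in X <= _]expn1 leq_exp2l.
  have b2 : 2 <= q ^ (d * p ^ m).
    apply: leq_trans (prime_gt1 pq) _.
    by rewrite -[X in X <= _]expn1 leq_exp2l ?prime_gt1 // muln_gt0 d0.
  apply: (@leq_trans (p ^ v * q ^ (d * p ^ m))).
    by move: (p ^ v) (q ^ _) a2 b2 => A B; clear; nia.
  rewrite /D mulnDl expnD; apply: leq_mul; first by rewrite leq_exp2l // leq_pmulr.
  rewrite (_ : d * q * p ^ m = q * (d * p ^ m)); last by rewrite mulnA (mulnC q).
  rewrite [X in _ <= X]expnM leq_exp2r ?muln_gt0 ?d0 //.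
  by apply: ltnW; apply: ltn_expl; exact: prime_gt1.
have := double_base_blocks v0 (dlog m) large (J := J) (n := n).
rewrite -/s => H; apply: double_base_leq (H _); last first.
  rewrite ltnNge; apply/negP => nbig.
  move: nk; rewrite ltnNge => /negP; apply.
  apply: (@leq_trans ((p ^ (m * J)) ^ (8 * s))); last first.
    rewrite leq_exp2r ?muln_gt0 //; apply: leq_trans nbig.
    by rewrite leq_exp2l // leq_addr.
  apply: (@leq_trans ((p ^ m * p ^ m) ^ (4 * s * J))); last first.
    by rewrite -expnD -!expnM leq_exp2l //; move: (m) (J) (s) => A B C; clear; lia.
  apply: (@leq_trans (k ^ (4 * s * J))); last first.
    by rewrite leq_exp2r //; apply: leq_trans kJ; apply: leq_trans ks; rewrite muln_gt0.
  by rewrite leq_pexp2l //; apply: leq_trans ks; rewrite muln_gt0.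
have fin (A B X y K : nat) : 2 * (A * B) * X <= K -> 2 * y <= K -> y + A * X * B <= K.
  by clear; lia.
by apply: fin mk _; rewrite mulnA.
Qed.

End DoubleBase.

End DoubleBaseExpansions.

(** * The two counting arguments and the theorem *)

(* For [d = 0] the relation [d %| n - _] is equality. *)
Lemma encoding_bound (T : finType) (v : T -> int) (d : int) (N k : nat) :
    d = 0 \/ (N <= `|d|)%N ->
    (forall n : nat, (0 < n <= N)%N ->
       exists c : 'I_k -> T, (d %| n%:Z - \sum_(i < k) v (c i))%Z) ->
  (N <= #|T| ^ k)%N.
Proof.
move=> dN cover.
have code (r : 'I_N) : exists c : {ffun 'I_k -> T},
    (d %| r.+1%:Z - \sum_(i < k) v (c i))%Z.
  have [|c dc] := cover r.+1; first by rewrite ltn_ord.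
  by exists (finfun c); under eq_bigr do rewrite ffunE.
have [f fP] := fin_all_exists code.
rewrite -[N]card_ord -[k]card_ord -card_ffun; apply: (leq_card f) => r1 r2 e12.
have : (d %| r1.+1%:Z - r2.+1%:Z)%Z.
  rewrite -[_ - _](subrKA (\sum_(i < k) v (f r1 i))).
  by rewrite rpredD // -opprB rpredN e12.
have [r1N r2N] := (ltn_ord r1, ltn_ord r2).
case: dN => [->|Nd]; first by rewrite dvd0z subr_eq0 => /eqP[] e; apply: val_inj.
rewrite dvdzE => dr; apply: val_inj => /=.
have [/eqP|] := posnP `|r1.+1%:Z - r2.+1%:Z|%N.
  by rewrite absz_eq0 subr_eq0 => /eqP[].
by move=> /dvdn_leq/(_ dr); lia.
Qed.

(** * Counting codes of summands *)

Section PowerProducts.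
Variables (P : {fset nat}).
Hypothesis primeP : forall p, p \in P -> prime p.

Definition code_value (d : nat) (f : {ffun P -> 'I_d}) : nat :=
  (\prod_(p : P) val p ^ f p)%N.

Lemma card_exponent_code d : #|{: {ffun P -> 'I_d}}| = (d ^ #|` P|)%N.
Proof. by rewrite card_ffun card_ord -cardfE. Qed.

Lemma unsigned_bound (k N : nat) :
    (forall n : nat, (0 < n <= N)%N -> sum_of k (power_products P) n%:Z) ->
  (N <= (1 + (trunc_log 2 N).+1 ^ #|` P|) ^ k)%N.
Proof.
move=> cover; pose l := trunc_log 2 N.
(* [None] encodes a zero summand. No summand exceeds [N], so its exponents are at most [l]. *)
pose v (c : option {ffun P -> 'I_l.+1}) : int :=
  if c is Some f then (code_value f)%:Z else 0.
suff : (N <= #|{: option {ffun P -> 'I_l.+1}}| ^ k)%N.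
  by rewrite card_option card_exponent_code add1n.
apply: (@encoding_bound _ v 0); first by left.
move=> n /andP[n0 nN]; have [|a [aP sum_a]] := cover n; first by rewrite n0.
have a_ge0 i : 0 <= a i by case: (aP i) => [[e ->] //|/= ->].
have a_le i : a i <= N%:Z.
  apply: (@le_trans _ _ n%:Z); last by rewrite lez_nat.
  by rewrite sum_a (bigD1 i) //= lerDl sumr_ge0.
have code i : exists c, a i = v c.
  case: (aP i) => [[e ae]|/= ->]; last by exists None.
  have el (p : P) : (e (val p) < l.+1)%N.
    have pp := primeP (valP p).
    rewrite ltnS; apply: trunc_log_max => //.
    have aN : (\prod_(p <- P) p ^ e p <= N)%N by rewrite -lez_nat -ae.
    apply: leq_trans aN.
    apply: (@leq_trans (val p ^ e (val p))).
      by case: (e (val p)) => // j; rewrite leq_exp2r // prime_gt1.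
    rewrite big_seq_fsetE /= (bigD1 p) //= leq_pmulr // prodn_cond_gt0 // => q _.
    by rewrite expn_gt0 prime_gt0 // primeP // (valP q).
  exists (Some [ffun p : P => Ordinal (el p)]); rewrite ae /= /code_value.
  by rewrite big_seq_fsetE /=; congr Posz; apply: eq_bigr => p _; rewrite ffunE.
have [c cP] := fin_all_exists code.
exists c; rewrite dvd0z sum_a subr_eq0; apply/eqP.
by apply: eq_bigr => i _.
Qed.

(** An exponent above [L] can be lowered by [L] without changing the residue. *)
Lemma exp_reduce m L a e : (0 < L)%N -> (forall a : nat, a ^ L.+1 = a %[mod m])%N ->
  exists e' : 'I_L.+1, (a ^ e = a ^ e' %[mod m])%N.
Proof.
move=> L0 aL; elim/ltn_ind: e => e IHe.
have [eL|Le] := ltnP e L.+1; first by exists (Ordinal eL).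
have [|e' ee'] := IHe (e - L)%N; first by lia.
exists e'; rewrite -ee' -{1}(subnK Le) expnD -modnMmr aL modnMmr -expnSr.
by congr (_ ^ _ %% _)%N; lia.
Qed.

Lemma signed_bound (k m L : nat) : (0 < m)%N -> (0 < L)%N ->
    (forall a : nat, a ^ L.+1 = a %[mod m])%N ->
    (forall n : nat, (0 < n <= m)%N -> sum_of k (signed_power_products P) n%:Z) ->
  (m <= (1 + 2 * L.+1 ^ #|` P|) ^ k)%N.
Proof.
move=> m0 L0 aL cover.
pose v (c : option (bool * {ffun P -> 'I_L.+1})) : int :=
  if c is Some (b, f) then (-1) ^+ b * (code_value f)%:Z else 0.
suff : (m <= #|{: option (bool * {ffun P -> 'I_L.+1})}| ^ k)%N.
  by rewrite card_option card_prod card_bool card_exponent_code add1n.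
(* The integers from 1 to [m] are distinct modulo [m], so codes need only be correct modulo [m]. *)
apply: (@encoding_bound _ v m%:Z); first by right.
move=> n nm; have [a [aP sum_a]] := cover n nm.
have prod_code (e : nat -> nat) : exists f : {ffun P -> 'I_L.+1},
    (m%:Z %| (\prod_(p <- P) p ^ e p)%N%:Z - (code_value f)%:Z)%Z.
  have [e' e'P] := fin_all_exists (fun p : P => exp_reduce (val p) (e (val p)) L0 aL).
  exists (finfun e'); rewrite -eqz_mod_dvd !modz_nat; apply/eqP; congr Posz.
  rewrite big_seq_fsetE /= /code_value.
  elim/big_ind2: _ => // [x1 x2 y1 y2 h1 h2|p _]; last by rewrite ffunE; exact: e'P.
  by rewrite -modnMm h1 h2 modnMm.
have code i : exists c, (m%:Z %| a i - v c)%Z.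
  case: (aP i) => [[[e ->]|[_ [e ->] <-]]|/= ->]; last 1 first.
    by exists None; rewrite subrr dvdz0.
    by have [f fP] := prod_code e; exists (Some (false, f)); rewrite /= mul1r.
  have [f fP] := prod_code e; exists (Some (true, f)).
  by rewrite /= expr1 mulN1r opprK addrC -opprB rpredN.
have [c cP] := fin_all_exists code.
exists c; rewrite sum_a -sumrB; apply: rpred_sum => i _; exact: cP.
Qed.

End PowerProducts.

(** * From the counting bounds to the extremal functions *)

Lemma least_non_sum_exists (k : nat) (S : set int) :
  (exists2 n : nat, (0 < n)%N & ~ sum_of k S n%:Z) -> exists n, least_non_sum k S n.
Proof.
move=> [n n0 nS].
pose Q n := `[< (0 < n)%N /\ ~ sum_of k S n%:Z >].
have exQ : exists n, Q n by exists n; apply/asboolP.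
exists (ex_minn exQ); case: ex_minnP => m /asboolP[m0 mS] mmin.
by split=> // m' m'0 m'S; apply: mmin; apply/asboolP.
Qed.

Lemma sum_of_double_base (P : {fset nat}) (p q k n : nat) :
    p \in P -> q \in P -> p != q -> double_base p q k n ->
  sum_of k (power_products P) n%:Z.
Proof.
move=> pP qP npq [s sk ->].
pose term (ab : nat * nat) : nat := (p ^ ab.1 * q ^ ab.2)%N.
(* The default value 0 of [nth] pads the list with zero summands. *)
pose a (i : 'I_k) : int := nth 0%N (map term s) i.
exists a; split.
  move=> i; have [is_|si] := ltnP i (size s); last first.
    by right; rewrite /a /= nth_default // size_map.
  left; pose ab := nth (0, 0)%N s i.
  exists (fun x => if x == p then ab.1 else if x == q then ab.2 else 0%N).
  rewrite /a (nth_map (0, 0)%N) // -/ab /term; congr Posz.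
  rewrite (big_fsetD1 p) //= eqxx (big_fsetD1 q) /=; last first.
    by rewrite !inE eq_sym npq.
  rewrite eq_sym (negbTE npq) eqxx big_seq big1 ?muln1 // => x.
  by rewrite !inE => /and3P[/negbTE -> /negbTE -> _].
rewrite -(big_morph Posz PoszD (erefl _)); congr Posz.
rewrite -(big_mkord xpredT (fun i => nth 0%N (map term s) i)).
rewrite (@big_cat_nat _ _ _ (size s)) //= [X in (_ + X)%N]big1_seq ?addn0.
  transitivity (\sum_(x <- map term s) x)%N; first by rewrite big_map.
  by rewrite [LHS](big_nth 0%N) size_map.
move=> i /andP[_]; rewrite mem_index_iota => /andP[si _].
by rewrite nth_default // size_map.
Qed.

Lemma nth_smallest_mem (P : {fset nat}) i : (i < #|` P|)%N -> nth_smallest P i \in P.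
Proof.
move=> iP; rewrite /nth_smallest -(mem_sort leq P).
by apply: mem_nth; rewrite size_sort.
Qed.

Lemma nth_smallest_neq (P : {fset nat}) i j : (i < #|` P|)%N -> (j < #|` P|)%N ->
  i != j -> nth_smallest P i != nth_smallest P j.
Proof.
move=> iP jP ij; rewrite /nth_smallest nth_uniq ?size_sort //.
by rewrite sort_uniq fset_uniq.
Qed.

Lemma double_base_powR_bound (R : realType) (p q : nat) :
    prime p -> prime q -> p != q ->
  exists2 c : R, 0 < c & forall k F : nat, (1 < k)%N ->
    ~ double_base p q k F -> k%:R `^ (c * k%:R) < F%:R.
Proof.
move=> pp pq npq; have [S [k0 [S0 repr]]] := double_base_lower pp pq npq.
have S0R : 1 <= S%:R :> R by rewrite (ler_nat _ 1).
have k0R : 0 <= k0%:R :> R by [].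
have S1 : 0 < 2 * S%:R * (k0%:R + 1) :> R by rewrite mulr_gt0; lra.
(* For [k < k0] the exponent is at most 1, and [k < F] because smaller numbers are sums of ones. For
   [k >= k0] the inequality [c * S < 1] makes [F ^ S < k ^ k] if the bound fails. *)
exists (2 * S%:R * (k0%:R + 1))^-1; first by rewrite invr_gt0.
move=> k F k1 kF; have k1R : 1 < k%:R :> R by rewrite (ltr_nat _ 1).
have kltF : (k < F)%N.
  by rewrite ltnNge; apply/negP => Fk; apply: kF; exact: double_base_nat.
have [kk0|k0k] := ltnP k k0.
  apply: (@le_lt_trans _ _ k%:R); last by rewrite ltr_nat.
  rewrite -[leRHS]powRr1 ?ler_powR //; first exact: ltW.
  rewrite mulrC ler_pdivrMr // mul1r.
  have : k%:R <= k0%:R :> R by rewrite ler_nat ltnW.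
  by move=> h; apply: le_trans h _; nra.
rewrite ltNge; apply/negP => Fle; apply: kF; apply: repr => //.
rewrite -(ltr_nat R) !natrX.
apply: (@le_lt_trans _ _ ((k%:R `^ ((2 * S%:R * (k0%:R + 1))^-1 * k%:R)) ^+ S)).
  by rewrite lerXn2r ?nnegrE ?powR_ge0.
rewrite -powR_mulrn ?powR_ge0 // -powRrM -[ltRHS]powR_mulrn ?ltW //; last first.
  exact: lt_trans k1R.
rewrite /powR !gt_eqF ?(lt_trans ltr01) // ltr_expR ltr_pM2r ?ln_gt0 //.
have -> : (2 * S%:R * (k0%:R + 1))^-1 * k%:R * S%:R = k%:R / (2 * (k0%:R + 1)) :> R.
  by field; rewrite !gt_eqF //=; lra.
by rewrite ltr_pdivrMr; nra.
Qed.

(* Writing [y] for the base [3 + trunc_log 2 F], the hypothesis gives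
   [y <= K M y ^ d] for each [d > 0], so [y <= (K M) ^ (1 / (1 - d))]. *)
Lemma powR_self_consistent (R : realType) (eps : R) : 0 < eps ->
  exists C : R, forall M F : nat, (0 < M)%N -> (0 < F)%N ->
    (F <= (3 + trunc_log 2 F) ^ M)%N -> F%:R <= C * M%:R `^ ((1 + eps) * M%:R).
Proof.
move=> eps0; pose e := eps / 2; have e0 : 0 < e by rewrite divr_gt0.
(* Thus [1 / (1 - d) = 1 + e]; the other half of [eps] absorbs the constant [K]. *)
pose d := e / (1 + e); have e1 : 0 < 1 + e by lra.
have d0 : 0 < d by rewrite divr_gt0.
have d1 : (1 - d) * (1 + e) = 1 by rewrite /d; field; rewrite gt_eqF.
pose K := 3 + 2 / d.
have K1 : 1 <= K by rewrite /K; have := divr_gt0 (ltr0n R 2) d0; lra.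
pose A := K `^ (1 + e); have A1 : 1 <= A by rewrite -(powRr0 K) ler_powR // ltW.
(* The factor [A ^ M] is at most [M ^ (e * M)] if [A <= M ^ e]; otherwise [M < A ^ (1 / e)], and
   this constant bounds it. *)
exists (A `^ (A `^ e^-1)) => M F M0 F0 FM.
have M1 : 1 <= M%:R :> R by rewrite (ler_nat _ 1).
pose l := trunc_log 2 F; pose y : R := 3 + l%:R.
have y1 : 1 <= y by rewrite /y; have : 0 <= l%:R :> R by []; lra.
have y0 : 0 < y by apply: lt_le_trans y1.
have Fy : F%:R <= y ^+ M.
  by rewrite /y -natrD -natrX ler_nat.
have lF : 2 ^+ l <= F%:R :> R by rewrite -natrX ler_nat trunc_logP.
have ln2 : 1 <= 2 * ln (2 : R).
  have := @le_ln1Dx R (- 2^-1).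
  rewrite (_ : 1 + - 2^-1 = 2^-1); last by field.
  by rewrite lnV ?posrE // => H; have := H ltac:(lra); lra.
have lny : l%:R <= 2 * M%:R * ln y.
  have : ln (2 ^+ l : R) <= ln (y ^+ M).
    by rewrite ler_ln ?posrE ?exprn_gt0 // (le_trans lF).
  rewrite !lnXn // -[ln 2 *+ l]mulr_natl -[ln y *+ M]mulr_natl.
  move=> h; apply: (@le_trans _ _ (l%:R * (2 * ln 2))); first by rewrite ler_peMr.
  by rewrite mulrCA -mulrA ler_wpM2l.
have lnd : ln y <= y `^ d / d.
  rewrite ler_pdivlMr //; have := @ln_sublinear R (y `^ d).
  by rewrite powR_gt0 // => /(_ isT) /ltW; rewrite ln_powR mulrC.
have yd1 : 1 <= y `^ d by rewrite -(powRr0 y) ler_powR // ltW.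
have yK : y <= K * M%:R * y `^ d.
  apply: (@le_trans _ _ (3 + 2 * M%:R * (y `^ d / d))).
    rewrite {1}/y lerD2l; apply: (le_trans lny); apply: (ler_wpM2l _ lnd).
    by rewrite mulr_ge0.
  rewrite /K.
  have -> : (3 + 2 / d) * M%:R * y `^ d = 3 * (M%:R * y `^ d) + 2 * M%:R * (y `^ d / d).
    by ring.
  by rewrite lerD2r; nra.
have yM : y <= (K * M%:R) `^ (1 + e).
  have h : y `^ (1 - d) <= K * M%:R.
    rewrite powRB; last by rewrite (gt_eqF y0) implybT.
    by rewrite powRr1 ?(ltW y0) // ler_pdivrMr ?powR_gt0.
  have -> : y = (y `^ (1 - d)) `^ (1 + e) by rewrite -powRrM d1 powRr1 // ltW.
  by apply: ge0_ler_powR; rewrite ?nnegrE ?powR_ge0 ?mulr_ge0 ?(ltW e1) //; lra.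
apply: le_trans Fy _.
apply: (@le_trans _ _ (((K * M%:R) `^ (1 + e)) ^+ M)).
  by rewrite lerXn2r ?nnegrE ?powR_ge0 // ltW.
have K0 : 0 <= K by apply: le_trans K1.
have A0 : 0 <= A by apply: le_trans A1.
have M0R : 0 < M%:R :> R by rewrite ltr0n.
rewrite powRM // -/A exprMn.
have -> : A ^+ M = A `^ M%:R by rewrite powR_mulrn.
have -> : (M%:R `^ (1 + e)) ^+ M = M%:R `^ ((1 + e) * M%:R).
  by rewrite -powR_mulrn ?powR_ge0 // -powRrM.
have -> : (1 + eps) * M%:R = e * M%:R + (1 + e) * M%:R by rewrite /e; field.
rewrite powRD; last by rewrite (gt_eqF M0R) implybT.
rewrite mulrA ler_wpM2r ?powR_ge0 // powRrM.
have [AM|MA] := leP A (M%:R `^ e).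
  apply: (@le_trans _ _ ((M%:R `^ e) `^ M%:R)).
    by apply: ge0_ler_powR; rewrite ?nnegrE ?powR_ge0.
  by rewrite ler_peMl ?powR_ge0 // -(powRr0 A) ler_powR // powR_ge0.
have Me1 : 1 <= (M%:R `^ e) `^ M%:R.
  by rewrite -powRrM -[leLHS](powRr0 (M%:R : R)) ler_powR // mulr_ge0 // ltW.
apply: (@le_trans _ _ (A `^ (A `^ e^-1))); last by rewrite ler_peMr ?powR_ge0.
apply: (ler_powR A1).
have -> : M%:R = (M%:R `^ e) `^ e^-1 :> R.
  by rewrite -powRrM divff ?gt_eqF // powRr1.
by apply: ge0_ler_powR; rewrite ?nnegrE ?powR_ge0 ?invr_ge0 ?(ltW e0) ?(ltW MA).
Qed.

Lemma sum_of_signed (k : nat) (P : {fset nat}) (n : int) :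
  sum_of k (power_products P) n -> sum_of k (signed_power_products P) n.
Proof.
by move=> [a [aP ->]]; exists a; split=> // i; case: (aP i) => ai; [left; left|right].
Qed.

Lemma expn2_lt_expR (R : realType) (M D : nat) : (0 < M)%N ->
  (2 ^ (M ^ D))%:R < expR (M%:R `^ D%:R) :> R.
Proof.
move=> M0; have -> : M%:R `^ D%:R = (M ^ D)%:R :> R by rewrite powR_mulrn // natrX.
have : (0 < M ^ D)%N by rewrite expn_gt0 M0.
move: (M ^ D)%N => n n0.
have e2 : 2 < expR 1 :> R by have := @expR_gt1Dx R 1 (oner_neq0 _); lra.
rewrite natrX -[X in expR X]mulr1 expRM_natl.
by rewrite ltrXn2r ?nnegrE ?expR_ge0 // -lt0n.
Qed.

Section Extremal.
Variable P : {fset nat}.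
Hypotheses (primeP : forall p, p \in P -> prime p) (P2 : (2 <= #|` P|)%N).

Lemma not_all_sums (k m : nat) (S : set int) :
    ~ (forall n : nat, (0 < n <= m)%N -> sum_of k S n%:Z) ->
  exists2 n : nat, (0 < n <= m)%N & ~ sum_of k S n%:Z.
Proof.
move=> H; apply: contrapT => nex; apply: H => n nm; apply: contrapT => nS.
by apply: nex; exists n.
Qed.

(** The counting bound holds for [F.-1]. The inequality [1 + x ^ e <= x.+1 ^ e] absorbs first the
    code of the zero summand, then the passage from [F.-1] to [F]. *)
Lemma least_unsigned_le (k F : nat) : (0 < k)%N ->
  least_non_sum k (power_products P) F ->
  (F <= (3 + trunc_log 2 F) ^ (k * #|` P|))%N.
Proof.
move=> k0 [F0 _ Fmin]; set t := #|` P|.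
have t0 : (0 < t)%N by apply: leq_trans P2.
have FN : (F.-1 <= (1 + (trunc_log 2 F.-1).+1 ^ t) ^ k)%N.
  apply: unsigned_bound => // n /andP[n0 nF]; apply: contrapT => nS.
  by have := Fmin n n0 nS; rewrite -(prednK F0) leqNgt ltnS nF.
set l := trunc_log 2 F.-1 in FN.
have lF : (l <= trunc_log 2 F)%N by apply: leq_trunc_log; exact: leq_pred.
have succ_pow (x e : nat) : (0 < e)%N -> (1 + x ^ e <= x.+1 ^ e)%N.
  case: e => // e _; elim: e => [|e IHe]; first by rewrite !expn1.
  rewrite expnS [leqRHS]expnS; apply: leq_trans (leq_mul (leqnn x.+1) IHe).
  by rewrite mulnDr muln1 mulSn; lia.
apply: (@leq_trans ((3 + l) ^ (k * t))); last first.
  by rewrite leq_exp2r ?muln_gt0 ?k0 // leq_add2l.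
apply: (@leq_trans (1 + (2 + l) ^ (k * t))); last first.
  by apply: succ_pow; rewrite muln_gt0 k0.
rewrite -(prednK F0) add1n ltnS; apply: leq_trans FN _.
rewrite mulnC expnM leq_exp2r //; exact: succ_pow.
Qed.

End Extremal.

Theorem theorem2 (R : realType) :
  exists (c : nat -> nat -> R) (C : R -> R) (Cpm : R),
    (forall p q : nat, 0 < c p q) /\
    forall (eps : R) (P : {fset nat}),
      0 < eps ->
      (forall p : nat, p \in P -> prime p) ->
      (2 <= #|` P|)%N ->
      exists F Fpm : nat -> nat,
        [/\ forall k : nat, (0 < k)%N ->
              least_non_sum k (power_products P) (F k),
            forall k : nat, (0 < k)%N ->
              least_non_sum k (signed_power_products P) (Fpm k),
            forall k : nat, (1 < k)%N ->
              k%:R `^ (c (nth_smallest P 0) (nth_smallest P 1) * k%:R)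
                < (F k)%:R,
            forall k : nat, (1 < k)%N ->
              (F k)%:R <=
                C eps * (k * #|` P|)%:R `^ ((1 + eps) * (k * #|` P|)%:R) &
            forall k : nat, (1 < k)%N ->
              (Fpm k)%:R < expR ((k * #|` P|)%:R `^ Cpm)].
Proof.
(* The constant is chosen for each pair before [P] is given; pairs that are not distinct primes get
   the value 1. *)
have /choice[c cP] : forall pq : nat * nat, exists c : R, 0 < c /\
    (prime pq.1 -> prime pq.2 -> pq.1 != pq.2 -> forall k F : nat, (1 < k)%N ->
     ~ double_base pq.1 pq.2 k F -> k%:R `^ (c * k%:R) < F%:R).
  move=> [p q] /=.
  case: (boolP [&& prime p, prime q & p != q]) => [/and3P[pp pq npq]|h].
    by have [c c0 cP] := double_base_powR_bound R pp pq npq; exists c.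
  by exists 1; split=> // pp pq npq; move: h; rewrite pp pq npq.
have /choice[C CP] : forall eps : R, exists C : R, 0 < eps ->
    forall M F : nat, (0 < M)%N -> (0 < F)%N ->
    (F <= (3 + trunc_log 2 F) ^ M)%N -> F%:R <= C * M%:R `^ ((1 + eps) * M%:R).
  move=> eps; have [eps0|neps] := ltP 0 eps; last by exists 0.
  by have [C CP] := powR_self_consistent eps0; exists C.
have [D DP] := modulus_exists.
exists (fun p q => c (p, q)), C, D%:R; split; first by move=> p q; case: (cP (p, q)).
move=> eps P eps0 primeP P2.
set t := #|` P|.
have signed k : (0 < k)%N -> exists2 n : nat, (0 < n <= 2 ^ ((k * t) ^ D))%N &
    ~ sum_of k (signed_power_products P) n%:Z.
  move=> k0; have [|m [L [m0 L0 aL mk mD]]] := DP (k * t)%N.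
    by apply: leq_trans P2 _; rewrite leq_pmull.
  have [|n /andP[n0 nm] nS] := @not_all_sums k m (signed_power_products P).
    by move/(signed_bound m0 L0 aL); rewrite leqNgt (mk k t).
  by exists n => //; rewrite n0 (leq_trans nm).
(* An integer that is no signed sum is no unsigned sum either, so the bound in [signed] also shows
   that [F] exists. *)
have /choice[F FP] : forall k, exists F, (0 < k)%N ->
    least_non_sum k (power_products P) F.
  move=> k; have [->|k0] := posnP k; first by exists 0%N.
  have [n /andP[n0 _] nS] := signed k k0.
  have [|f fP] := @least_non_sum_exists k (power_products P); last by exists f.
  by exists n => // /sum_of_signed.
have /choice[Fpm FpmP] : forall k, exists F, (0 < k)%N ->
    least_non_sum k (signed_power_products P) F.
  move=> k; have [->|k0] := posnP k; first by exists 0%N.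
  have [n /andP[n0 _] nS] := signed k k0.
  have [|f fP] := @least_non_sum_exists k (signed_power_products P); last by exists f.
  by exists n.
exists F, Fpm; split=> // k k1; have k0 : (0 < k)%N := ltnW k1.
- have [_ nS _] := FP k k0.
  have P0 : (0 < t)%N := ltnW P2.
  have [m0 m1] := (nth_smallest_mem P0, nth_smallest_mem P2).
  have n01 := nth_smallest_neq P0 P2 (isT : 0%N != 1%N).
  have [_ /= cb] := cP (nth_smallest P 0, nth_smallest P 1).
  apply: cb => //; try exact: primeP.
  by move=> db; apply: nS; exact: sum_of_double_base m0 m1 n01 db.
- have [F0 _ _] := FP k k0; apply: CP => //; first by rewrite muln_gt0 k0 ltnW.
  exact: least_unsigned_le (FP k k0).
have [n /andP[n0 nD] nS] := signed k k0; have [_ _ Fmin] := FpmP k k0.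
apply: le_lt_trans (expn2_lt_expR R D (_ : 0 < k * t)%N); last first.
  by rewrite muln_gt0 k0 ltnW.
by rewrite ler_nat (leq_trans (Fmin n n0 nS)).
Qed.
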